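(* Let $\mathsf{t}$ be the modified trace on $\mathrm{Proj}_{\bar U_q}$ normalized by $\mathsf{t}_{\mathcal{X}^+(p)}(\mathrm{Id})=(-1)^{p-1}$, and let $\mu\in \bar U_q^*$ be the right integral normalized by $$\mu(F^mE^nK^j)=(-1)^{p-1}\,2p\,([p-1]!)^2\,\delta_{m,p-1}\delta_{n,p-1}\delta_{j,p+1}\qquad (0\le m,n\le p-1,\ 0\le j\le 2p-1).$$ Then the symmetric linear form corresponding to $\mathsf{t}$ is $\Pi_{\bar U_q}(\mathsf{t})=\mu(K^{p+1}\,\cdot)$, and $$\mu(K^{p+1}\cdot) = (-1)^{p-1}\chi^+_p + \chi^-_p + \sum_{s=1}^{p-1} \left( (-1)^s(q^s+q^{-s})\chi^+_s + (-1)^{p-s-1}(q^s+q^{-s})\chi^-_s + (-1)^s[s]^2G_s \right).$$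
   Context: Let $p\ge 2$ be an integer, $q=e^{i\pi/p}$, $[n]=\frac{q^n-q^{-n}}{q-q^{-1}}$, $[m]!=[1]\cdots[m]$, $[0]!=1$. $\bar U_q=\bar U_q(\mathfrak{sl}(2))$ is the $2p^3$-dimensional $\mathbb{C}$-algebra generated by $E,F,K$ with relations $E^p=F^p=0$, $K^{2p}=1$, $KE=q^2EK$, $KF=q^{-2}FK$, $EF=FE+\frac{K-K^{-1}}{q-q^{-1}}$; it is a Hopf algebra with $\Delta(E)=1\otimes E+E\otimes K$, $\Delta(F)=F\otimes1+K^{-1}\otimes F$, $\Delta(K)=K\otimes K$, $\varepsilon(E)=\varepsilon(F)=0$, $\varepsilon(K)=1$, $S(E)=-EK^{-1}$, $S(F)=-KF$, $S(K)=K^{-1}$, and pivotal element $g=K^{p+1}$. The monomials $F^mE^nK^j$ ($0\le m,n\le p-1$, $0\le j\le 2p-1$) form a basis. All modules are finite dimensional left modules. A right integral $\mu\in\bar U_q^*$ is a linear form with $(\mu\otimes\mathrm{Id})(\Delta(x))=\mu(x)1$ for all $x$. Simple modules: for $\alpha\in\{\pm\}$ (identified with $\pm1$) and $1\le s\le p$, $\mathcal{X}^\alpha(s)$ has basis $(v_i)_{0\le i\le s-1}$ with $Kv_i=\alpha q^{s-1-2i}v_i$, $Ev_0=0$, $Ev_i=\alpha[i][s-i]v_{i-1}$ ($i\ge1$), $Fv_i=v_{i+1}$ ($i\le s-2$), $Fv_{s-1}=0$. $\mathcal{X}^\pm(p)$ are also projective. Projective modules: for $1\le s\le p-1$, $\mathcal{P}^\alpha(s)$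 (the projective cover of $\mathcal{X}^\alpha(s)$) has a standard basis $(b_i,x_j,y_k,a_l)$, $0\le i,l\le s-1$, $0\le j,k\le p-s-1$, with $Kb_i=\alpha q^{s-1-2i}b_i$, $Eb_i=\alpha[i][s-i]b_{i-1}+a_{i-1}$ ($i\ge1$), $Eb_0=x_{p-s-1}$, $Fb_i=b_{i+1}$ ($i\le s-2$), $Fb_{s-1}=y_0$; $Kx_j=-\alpha q^{p-s-1-2j}x_j$, $Ex_j=-\alpha[j][p-s-j]x_{j-1}$ ($j\ge1$), $Ex_0=0$, $Fx_j=x_{j+1}$ ($j\le p-s-2$), $Fx_{p-s-1}=a_0$; $Ky_k=-\alpha q^{p-s-1-2k}y_k$, $Ey_k=-\alpha[k][p-s-k]y_{k-1}$ ($k\ge1$), $Ey_0=a_{s-1}$, $Fy_k=y_{k+1}$ ($k\le p-s-2$), $Fy_{p-s-1}=0$; $Ka_l=\alpha q^{s-1-2l}a_l$, $Ea_l=\alpha[l][s-l]a_{l-1}$ ($l\ge1$), $Ea_0=0$, $Fa_l=a_{l+1}$ ($l\le s-2$), $Fa_{s-1}=0$. $p^\alpha_s\in\mathrm{End}_{\bar U_q}(\mathcal{P}^\alpha(s))$ is the endomorphism determined by $p^\alpha_s(b_0)=a_0$. $\mathrm{SLF}(\bar U_q)$ is the space of linear forms $\varphi$ on $\bar U_q$ with $\varphi(xy)=\varphi(yx)$. Define $\chi^\alpha_s(x)=\mathrm{tr}(x|_{\mathcal{X}^\alpha(s)})$ for $1\le s\le p$. For $1\le s\le p-1$ and $x\in\bar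 U_q$, let $H^\alpha_s(x)$ be the $s\times s$ matrix whose $(l,i)$ entry is the coefficient of $a_l$ in $x b_i$ in the standard basis of $\mathcal{P}^\alpha(s)$, and $G_s=\mathrm{tr}(H^+_s)+\mathrm{tr}(H^-_{p-s})$. It is known that the $\chi^\pm_s$ ($1\le s\le p$) and $G_{s}$ ($1\le s\le p-1$) form a basis of $\mathrm{SLF}(\bar U_q)$. $\mathrm{Proj}_{\bar U_q}$ is the full subcategory of finite dimensional projective left $\bar U_q$-modules. A trace on it is a family of linear maps $t=(t_U:\mathrm{End}_{\bar U_q}(U)\to\mathbb{C})_{U\in \mathrm{Proj}_{\bar U_q}}$ such that $t_U(g\circ f)=t_V(f\circ g)$ for all $f\in\mathrm{Hom}_{\bar U_q}(U,V)$, $g\in\mathrm{Hom}_{\bar U_q}(V,U)$. $\Pi_{\bar U_q}(t)\in\mathrm{SLF}(\bar U_q)$ is defined by $\Pi_{\bar U_q}(t)(a)=t_{\bar U_q}(\rho_a)$, where $\bar U_q$ is the left regular module and $\rho_a(x)=xa$. A modified trace is a trace $\mathsf{t}$ on $\mathrm{Proj}_{\bar U_q}$ such that for every $U\in\mathrm{Proj}_{\bar U_q}$, every module $V$ and every $f\in\mathrm{End}_{\bar U_q}(U\otimes V)$, $\mathsf{t}_{U\otimes V}(f)=\mathsf{t}_U(\mathrm{tr}_R(f))$, where $\mathrm{tr}_R$ is the right partial quantum trace $\mathrm{tr}_R(f)(u)=\sum_i(\mathrm{Id}\otimes v^i)\big((1\otimes K^{p+1})f(u\otimes v_i)\big)$,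 with $(v_i)$ a basis of $V$ and $(v^i)$ its dual basis. It is known (and may be used) that a modified trace on $\mathrm{Proj}_{\bar U_q}$ is unique up to scalar and that, with the normalization $\mathsf{t}_{\mathcal{X}^+(p)}(\mathrm{Id})=(-1)^{p-1}$, its values are $\mathsf{t}_{\mathcal{X}^-(p)}(\mathrm{Id})=1$ and, for $1\le s\le p-1$, $\mathsf{t}_{\mathcal{P}^+(s)}(\mathrm{Id})=(-1)^s(q^s+q^{-s})$, $\mathsf{t}_{\mathcal{P}^-(s)}(\mathrm{Id})=(-1)^{p-s-1}(q^s+q^{-s})$, $\mathsf{t}_{\mathcal{P}^+(s)}(p^+_s)=(-1)^s[s]^2$, $\mathsf{t}_{\mathcal{P}^-(s)}(p^-_s)=\mathsf{t}_{\mathcal{P}^+(p-s)}(p^+_{p-s})$. *)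

(* Defs.v *)
From HB Require Import structures.
From mathcomp Require Import all_boot all_order all_algebra all_field.
From mathcomp Require Import complex reals trigo.

Set Implicit Arguments.
Unset Strict Implicit.
Unset Printing Implicit Defensive.
Import GRing.Theory ComplexField.
Local Open Scope ring_scope.

(* ------------------------------------------------------------------------ *)
(* Tensor product of finite dimensional vector spaces, as the space of      *)
(* coordinate matrices with respect to the bases vbasis {:V}, vbasis {:W}.  *)
(* pure v w is the element v (x) w, and tlift beta is the linear map on the *)
(* tensor product induced by a bilinear map beta (see tlift_pure).          *)
(* ------------------------------------------------------------------------ *)
Section Tensor.
Variable C : fieldType.
Implicit Types V W : vectType C.

Definition tensor V W : vectType C := 'M[C]_(\dim {:V}, \dim {:W}).

Definition pure V W (v : V) (w : W) : tensor V W :=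
  \matrix_(i, j) (coord (vbasis {:V}) i v * coord (vbasis {:W}) j w).

Definition tlift V W (X : lmodType C) (beta : V -> W -> X)
    (t : tensor V W) : X :=
  \sum_(i < \dim {:V}) \sum_(j < \dim {:W})
    t i j *: beta (vbasis {:V})`_i (vbasis {:W})`_j.

Fact tlift_is_linear V W (X : lmodType C) (beta : V -> W -> X) :
  linear (tlift beta).
Proof.
move=> c s t; rewrite /tlift scaler_sumr -big_split; apply: eq_bigr => i _ /=.
rewrite scaler_sumr -big_split; apply: eq_bigr => j _ /=.
by rewrite !mxE scalerDl scalerA.
Qed.

HB.instance Definition _ V W (X : lmodType C) (beta : V -> W -> X) :=
  GRing.isSemilinear.Build C (tensor V W) X _ (tlift beta)
    (GRing.semilinear_linear (tlift_is_linear beta)).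

Definition bilin V W (X : lmodType C) (beta : V -> W -> X) : Prop :=
  (forall w, linear (beta^~ w)) /\ (forall v, linear (beta v)).

Definition tmap V W V' W' (f : 'Hom(V, V')) (g : 'Hom(W, W')) :
    'Hom(tensor V W, tensor V' W') :=
  linfun (tlift (fun v w => pure (f v) (g w))).

(* Product of the algebra A (x) A: (a (x) b) (a' (x) b') = aa' (x) bb'. *)
Definition tmul (A : falgType C) (s t : tensor A A) : tensor A A :=
  tlift (fun a b => tlift (fun a' b' => pure (a * a') (b * b')) t) s.

Lemma tlift_pure V W (X : lmodType C) (beta : V -> W -> X) v w :
  bilin beta -> tlift beta (pure v w) = beta v w.
Proof.
case=> betaL betaR.
have sumL n (c : 'I_n -> C) (e : 'I_n -> V) w' :
    beta (\sum_i c i *: e i) w' = \sum_i c i *: beta (e i) w'.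
  pose m := GRing.isSemilinear.Build C V X _ _ (GRing.semilinear_linear (betaL w')).
  pose f : {linear V -> X} := HB.pack (beta^~ w') m.
  rewrite -[LHS]/(f _) raddf_sum; apply: eq_bigr => i _; exact: linearZ.
have sumR n (c : 'I_n -> C) (e : 'I_n -> W) v' :
    beta v' (\sum_i c i *: e i) = \sum_i c i *: beta v' (e i).
  pose m := GRing.isSemilinear.Build C W X _ _ (GRing.semilinear_linear (betaR v')).
  pose f : {linear W -> X} := HB.pack (beta v') m.
  rewrite -[LHS]/(f _) raddf_sum; apply: eq_bigr => i _; exact: linearZ.
rewrite [in RHS](coord_vbasis (memvf v)) [in RHS](coord_vbasis (memvf w)).
rewrite sumL /tlift; apply: eq_bigr => i _.
rewrite sumR scaler_sumr; apply: eq_bigr => j _.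
by rewrite mxE scalerA.
Qed.

Lemma eq_tlift V W (X : lmodType C) (beta beta' : V -> W -> X) t :
  (forall v w, beta v w = beta' v w) -> tlift beta t = tlift beta' t.
Proof.
by move=> eqb; apply: eq_bigr => i _; apply: eq_bigr => j _; rewrite eqb.
Qed.

Lemma linear_tlift V W (X Y : lmodType C) (f : {linear X -> Y})
    (beta : V -> W -> X) t :
  f (tlift beta t) = tlift (fun v w => f (beta v w)) t.
Proof.
rewrite /tlift linear_sum; apply: eq_bigr => i _; rewrite linear_sum.
by apply: eq_bigr => j _; rewrite linearZ_LR.
Qed.

Lemma tlift_lfunE V W (X Y : vectType C) (beta : V -> W -> 'Hom(X, Y)) t x :
  tlift beta t x = tlift (fun v w => beta v w x) t.
Proof.
rewrite /tlift sum_lfunE; apply: eq_bigr => i _; rewrite sum_lfunE.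
by apply: eq_bigr => j _; rewrite scale_lfunE.
Qed.

Fact pure_bilin V W : bilin (@pure V W).
Proof.
split=> [w c v v' | v c w w']; apply/matrixP => i j; rewrite !mxE linearP /=.
  by rewrite mulrDl mulrA.
by rewrite mulrDr mulrCA.
Qed.

Fact tensor_ext V W (X : lmodType C) (f g : {linear tensor V W -> X}) :
  (forall v w, f (pure v w) = g (pure v w)) -> f =1 g.
Proof.
move=> fg t.
have -> : t = \sum_i \sum_j t i j *: pure (vbasis {:V})`_i (vbasis {:W})`_j.
  have ev i j k l : (t i j *: pure (vbasis {:V})`_i (vbasis {:W})`_j) k l
      = t i j * ((i == k)%:R * (j == l)%:R).
    rewrite !mxE !coord_free ?(basis_free (vbasisP _)) //.
  apply/matrixP => k l; rewrite summxE (bigD1 k) //= summxE (bigD1 l) //=.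
  rewrite ev !eqxx !mulr1 !big1 ?addr0 // => [i /negPf ik | j /negPf jl].
    by rewrite summxE big1 // => j _; rewrite ev ik mul0r mulr0.
  by rewrite ev jl !mulr0.
rewrite !linear_sum; apply: eq_bigr => i _; rewrite !linear_sum.
by apply: eq_bigr => j _; rewrite !linearZ_LR /= fg.
Qed.

Fact tmap_pure V W V' W' (f : 'Hom(V, V')) (g : 'Hom(W, W')) v w :
  tmap f g (pure v w) = pure (f v) (g w).
Proof.
rewrite lfunE /= tlift_pure //; have [pL pR] := pure_bilin V' W'.
by split=> [y c x x' | x c y y']; rewrite linearP ?pL ?pR.
Qed.

End Tensor.

(* ------------------------------------------------------------------------ *)
Section HopfModules.
Variable C : fieldType.

Record fdmod (A : falgType C) := FdMod {
  mcar :> vectType C;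
  act : {linear A -> 'End(mcar)};
  act1 : act 1 = \1%VF;
  actM : forall x y, act (x * y) = (act x \o act y)%VF }.

Record hopfAlg := HopfAlg {
  hsort :> falgType C;
  cop : {linear hsort -> tensor hsort hsort};
  cou : {scalar hsort};
  anti : {linear hsort -> hsort};
  cop1 : cop 1 = pure 1 1;
  copM : forall x y, cop (x * y) = tmul (cop x) (cop y);
  cou1 : cou 1 = 1;
  couM : forall x y, cou (x * y) = cou x * cou y;
  coassoc : forall x,
    tlift (fun a b => tlift (fun b1 b2 => pure (pure a b1) b2) (cop b)) (cop x)
      = tlift (fun a b => pure (cop a) b) (cop x);
  counitl : forall x, tlift (fun a b => cou a *: b) (cop x) = x;
  counitr : forall x, tlift (fun a b => cou b *: a) (cop x) = x;
  antipodel : forall x, tlift (fun a b => anti a * b) (cop x) = cou x *: 1;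
  antipoder : forall x, tlift (fun a b => a * anti b) (cop x) = cou x *: 1 }.

Arguments cop {_}.
Arguments cou {_}.
Arguments anti {_}.

Definition mod_hom (A : falgType C) (M N : fdmod A) (f : 'Hom(M, N)) : Prop :=
  forall x v, f (act M x v) = act N x (f v).

Definition projective (A : falgType C) (P : fdmod A) : Prop :=
  forall (M N : fdmod A) (g : 'Hom(M, N)) (f : 'Hom(P, N)),
    mod_hom g -> mod_hom f -> (forall y, exists x, g x = y) ->
    exists h : 'Hom(P, M), mod_hom h /\ (g \o h)%VF = f.

Definition mchar (A : falgType C) (M : fdmod A) (x : A) : C :=
  \tr (passmx.mxof (vbasis {:M}) (vbasis {:M}) (act M x)).

Fact reg_act1 (A : falgType C) : @amull C A 1 = \1%VF.
Proof. exact: amull1. Qed.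

Fact reg_actM (A : falgType C) (x y : A) :
  amull (x * y) = (amull x \o amull y)%VF.
Proof. by apply/lfunP => z; rewrite comp_lfunE !lfunE /= mulrA. Qed.

Definition regular (A : falgType C) : fdmod A :=
  @FdMod A A (@amull C A) (reg_act1 A) (@reg_actM A).

Section TensorModule.
Variables (H : hopfAlg) (M N : fdmod H).

Definition tensor_act (x : H) : 'End(tensor M N) :=
  tlift (fun a b => tmap (act M a) (act N b)) (cop x).

Fact tensor_act_is_linear : linear tensor_act.
Proof. by move=> c x y; rewrite /tensor_act !linearP. Qed.

HB.instance Definition _ := GRing.isSemilinear.Build C H 'End(tensor M N) _
  tensor_act (GRing.semilinear_linear tensor_act_is_linear).

Let tact (a b : H) := tmap (act M a) (act N b).

Let tact_bilin : bilin tact.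
Proof.
have [pL pR] := pure_bilin M N.
split=> [b c a a' | a c b b']; apply/lfunP; apply: tensor_ext => v w;
  rewrite /tact [RHS]add_lfunE scale_lfunE !tmap_pure;
  rewrite [LHS]tmap_pure linearP add_lfunE scale_lfunE.
- exact: pL.
- exact: pR.
Qed.

Let tactM a b a' b' : tact (a * a') (b * b') = (tact a b \o tact a' b')%VF.
Proof.
apply/lfunP; apply: tensor_ext => v w.
rewrite [RHS]comp_lfunE /tact !tmap_pure [LHS]tmap_pure !actM.
by rewrite !comp_lfunE.
Qed.

Fact tensor_act1 : tensor_act 1 = \1%VF.
Proof.
rewrite /tensor_act cop1 tlift_pure; last exact: tact_bilin.
apply/lfunP; apply: tensor_ext => v w.
by rewrite [LHS]tmap_pure !act1 [RHS]id_lfunE !id_lfunE.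
Qed.

Fact tensor_actM x y : tensor_act (x * y) = (tensor_act x \o tensor_act y)%VF.
Proof.
rewrite /tensor_act copM; move: (cop x) (cop y) => s t.
apply/lfunP => z; rewrite comp_lfunE -/tact !tlift_lfunE /tmul.
rewrite [LHS](linear_tlift (tlift (fun v w => tact v w z))).
apply: eq_tlift => a b; rewrite [LHS](linear_tlift (tlift _)) linear_tlift.
apply: eq_tlift => a' b'; rewrite [LHS]tlift_pure ?tactM ?comp_lfunE //.
have [tL tR] := tact_bilin.
by split=> [b1 c x1 x2 | x1 c b1 b2]; rewrite ?tL ?tR add_lfunE scale_lfunE.
Qed.

Definition tensor_mod : fdmod H :=
  @FdMod H (tensor M N) tensor_act tensor_act1 tensor_actM.

End TensorModule.

(* A trace on projective modules is given as a family t of total functions   *)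
(* on C-linear endomorphisms of all modules; only its values on the module   *)
(* endomorphisms of projective modules are meaningful and constrained.       *)
Definition is_trace (A : falgType C) (t : forall M : fdmod A, 'End(M) -> C) :
    Prop :=
  (forall U : fdmod A, projective U ->
     forall (c : C) (f g : 'End(U)), mod_hom f -> mod_hom g ->
     t U (c *: f + g) = c * t U f + t U g) /\
  (forall U V : fdmod A, projective U -> projective V ->
     forall (f : 'Hom(U, V)) (g : 'Hom(V, U)), mod_hom f -> mod_hom g ->
     t U (g \o f)%VF = t V (f \o g)%VF).

(* Right partial quantum trace for the pivotal element piv:                  *)
(* u |-> \sum_i (Id (x) v^i) ((1 (x) piv) f (u (x) v_i)).                    *)
Definition ptrace (H : hopfAlg) (piv : H) (U V : fdmod H)
    (f : 'End(tensor_mod U V)) : 'End(U) :=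
  linfun (fun u : U => \sum_(i < \dim {:V})
    tlift (fun u' v' => coord (vbasis {:V}) i v' *: u')
      (tmap \1%VF (act V piv) (f (pure u (vbasis {:V})`_i)))).

Definition is_modified_trace (H : hopfAlg) (piv : H)
    (t : forall M : fdmod H, 'End(M) -> C) : Prop :=
  is_trace t /\
  forall U V : fdmod H, projective U ->
    forall f : 'End(tensor_mod U V), mod_hom f ->
    t (tensor_mod U V) f = t U (ptrace piv f).

Definition trace_slf (A : falgType C) (t : forall M : fdmod A, 'End(M) -> C)
    (a : A) : C :=
  t (regular A) (amulr a).

Definition right_integral (H : hopfAlg) (mu : {scalar H}) : Prop :=
  forall x : H, tlift (fun a b => mu a *: b) (cop x) = mu x *: 1.

Definition qint (q : C) (n : nat) : C := (q ^+ n - q ^- n) / (q - q^-1).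

Definition qfact (q : C) (n : nat) : C := \prod_(1 <= i < n.+1) qint q i.

(* The 2p^3-dimensional algebra generated by E, F, K with the given          *)
(* relations, with its Hopf structure. As the relations bound the dimension  *)
(* of any algebra generated by E, F, K by 2p^3, the dimension condition says *)
(* that there are no further relations.                                      *)
Record is_Uqsl2 (p : nat) (q : C) (H : hopfAlg) (E F K : H) : Prop := IsUqsl2 {
  uq_dim : \dim {:H} = (2 * p ^ 3)%N;
  uq_gen : agenv <<[:: E; F; K]>> = {:H}%VS;
  uq_Ep : E ^+ p = 0;
  uq_Fp : F ^+ p = 0;
  uq_K2p : K ^+ (2 * p) = 1;
  uq_KE : K * E = q ^+ 2 *: (E * K);
  uq_KF : K * F = q ^- 2 *: (F * K);
  uq_EF : E * F = F * E + (q - q^-1)^-1 *: (K - K^-1);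
  uq_copE : cop E = pure 1 E + pure E K;
  uq_copF : cop F = pure F 1 + pure K^-1 F;
  uq_copK : cop K = pure K K;
  uq_couE : cou E = 0;
  uq_couF : cou F = 0;
  uq_couK : cou K = 1;
  uq_antiE : anti E = - (E * K^-1);
  uq_antiF : anti F = - (K * F);
  uq_antiK : anti K = K^-1 }.

(* Signs are encoded by booleans: false stands for + and true for -.         *)
Definition sgnb (alpha : bool) : C := (-1) ^+ alpha.

Record is_stdbasis_simple (q : C) (A : falgType C) (E F K : A) (alpha : bool)
    (s : nat) (X : fdmod A) (v : s.-tuple X) : Prop := IsStdbasisSimple {
  sim_basis : basis_of {:X} v;
  sim_K : forall i, (i < s)%N ->
    act X K v`_i = (sgnb alpha * q ^ (s%:Z - 1 - 2 * i%:Z)) *: v`_i;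
  sim_E0 : act X E v`_0 = 0;
  sim_E : forall i, (0 < i < s)%N ->
    act X E v`_i = (sgnb alpha * qint q i * qint q (s - i)) *: v`_i.-1;
  sim_F : forall i, (i.+1 < s)%N -> act X F v`_i = v`_i.+1;
  sim_Flast : act X F v`_s.-1 = 0 }.

Definition is_simple_X (q : C) (A : falgType C) (E F K : A) (alpha : bool)
    (s : nat) (X : fdmod A) : Prop :=
  exists v : s.-tuple X, is_stdbasis_simple q E F K alpha v.

Record based_mod (A : falgType C) (p s : nat) := BasedMod {
  bmod :> fdmod A;
  vb : s.-tuple bmod;
  vx : (p - s).-tuple bmod;
  vy : (p - s).-tuple bmod;
  va : s.-tuple bmod }.

Definition stdbasis (A : falgType C) (p s : nat) (P : based_mod A p s) :=
  [tuple of vb P ++ vx P ++ vy P ++ va P].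

Record is_proj_P (q : C) (A : falgType C) (E F K : A) (p : nat) (alpha : bool)
    (s : nat) (P : based_mod A p s) : Prop := IsProjP {
  prj_basis : basis_of {:P} (stdbasis P);
  prj_Kb : forall i, (i < s)%N ->
    act P K (vb P)`_i = (sgnb alpha * q ^ (s%:Z - 1 - 2 * i%:Z)) *: (vb P)`_i;
  prj_Eb : forall i, (0 < i < s)%N ->
    act P E (vb P)`_i =
      (sgnb alpha * qint q i * qint q (s - i)) *: (vb P)`_i.-1 + (va P)`_i.-1;
  prj_Eb0 : act P E (vb P)`_0 = (vx P)`_(p - s).-1;
  prj_Fb : forall i, (i.+1 < s)%N -> act P F (vb P)`_i = (vb P)`_i.+1;
  prj_Fblast : act P F (vb P)`_s.-1 = (vy P)`_0;
  prj_Kx : forall j, (j < p - s)%N ->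
    act P K (vx P)`_j =
      (- sgnb alpha * q ^ (p%:Z - s%:Z - 1 - 2 * j%:Z)) *: (vx P)`_j;
  prj_Ex : forall j, (0 < j < p - s)%N ->
    act P E (vx P)`_j =
      (- sgnb alpha * qint q j * qint q (p - s - j)) *: (vx P)`_j.-1;
  prj_Ex0 : act P E (vx P)`_0 = 0;
  prj_Fx : forall j, (j.+1 < p - s)%N -> act P F (vx P)`_j = (vx P)`_j.+1;
  prj_Fxlast : act P F (vx P)`_(p - s).-1 = (va P)`_0;
  prj_Ky : forall k, (k < p - s)%N ->
    act P K (vy P)`_k =
      (- sgnb alpha * q ^ (p%:Z - s%:Z - 1 - 2 * k%:Z)) *: (vy P)`_k;
  prj_Ey : forall k, (0 < k < p - s)%N ->
    act P E (vy P)`_k =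
      (- sgnb alpha * qint q k * qint q (p - s - k)) *: (vy P)`_k.-1;
  prj_Ey0 : act P E (vy P)`_0 = (va P)`_s.-1;
  prj_Fy : forall k, (k.+1 < p - s)%N -> act P F (vy P)`_k = (vy P)`_k.+1;
  prj_Fylast : act P F (vy P)`_(p - s).-1 = 0;
  prj_Ka : forall l, (l < s)%N ->
    act P K (va P)`_l = (sgnb alpha * q ^ (s%:Z - 1 - 2 * l%:Z)) *: (va P)`_l;
  prj_Ea : forall l, (0 < l < s)%N ->
    act P E (va P)`_l =
      (sgnb alpha * qint q l * qint q (s - l)) *: (va P)`_l.-1;
  prj_Ea0 : act P E (va P)`_0 = 0;
  prj_Fa : forall l, (l.+1 < s)%N -> act P F (va P)`_l = (va P)`_l.+1;
  prj_Falast : act P F (va P)`_s.-1 = 0 }.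

(* Entry (l, i) is the coefficient of a_l in x b_i; the triple rshift skips  *)
(* the blocks b, x, y of the standard basis.                                 *)
Definition Hmat (A : falgType C) (p s : nat) (P : based_mod A p s) (x : A) :
    'M[C]_s :=
  \matrix_(l, i) coord (stdbasis P)
    (rshift s (rshift (p - s) (rshift (p - s) l))) (act P x (vb P)`_i).

Definition Gform (A : falgType C) (p : nat)
    (P : bool -> forall s : nat, based_mod A p s) (s : nat) (x : A) : C :=
  \tr (Hmat (P false s) x) + \tr (Hmat (P true (p - s)%N) x).

End HopfModules.

Definition qroot (R : realType) (p : nat) : R[i] :=
  Complex (cos (pi / p%:R)) (sin (pi / p%:R)).

(* Main.v *)
(* The generators E, F, K commute up to scalars and lower order terms, so the
   monomials F^m E^n K^j (m, n < p, j < 2p) span the algebra, and it suffices to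
   compare the three linear forms Pi(t), mu(K^(p+1) .) and the combination of
   characters on them. Each vanishes on every monomial but F^(p-1) E^(p-1), where
   its value is (-1)^(p-1) 2p ([p-1]!)^2. For mu this is its normalization.

   For Pi(t): given a module V, v in V and a linear form xi on V, the map
   a |-> a.(1 (x) v) from the regular module U to U (x) V has xi(v) times the
   identity as composite with (id (x) xi) o Phi^-1, where Phi(x (x) w) =
   x.(1 (x) w). Cyclicity and the partial trace property of t then give
     xi(v) Pi(t)(a) = Pi(t)((id (x) xi o K^(p+1)) (a.(1 (x) v))).
   For V the two dimensional simple module these equations kill Pi(t) on all
   monomials but F^(p-1) E^(p-1); the remaining value follows from t(Id) on
   X^+(p), which is a direct summand of the regular module.

   For the characters: modulo monomials of smaller degree, (q - q^-1)^(2m) F^m E^m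
   is the m-th power of the Casimir element, so it suffices to evaluate the
   combination on casimir^l K^j. With c = x + 1/x and x = q^s, the terms of index
   s in the formula add up to a multiple of
   (-1)^s (c^(l+1) + l (x - 1/x)^2 c^(l-1)), the value at q^s of x d/dx applied
   to the Laurent polynomial (x - 1/x) (x + 1/x)^l; the sum over s is a Fourier
   sum over the 2p-th roots of unity. *)

Require Import Defs.
From HB Require Import structures.
From mathcomp Require Import all_boot all_order all_algebra all_field.
From mathcomp Require Import complex reals trigo.
From mathcomp Require Import ring zify.
Import GRing.Theory.
Local Open Scope ring_scope.

Set Implicit Arguments.
Unset Strict Implicit.
Unset Printing Implicit Defensive.

(** * Spans, generated algebras and traces of endomorphisms *)

Section LinearAlgebra.
Variable C : fieldType.

Lemma span_linear_eq (V W : vectType C) (X : seq V) (f g : {linear V -> W}) :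
  <<X>>%VS = fullv -> {in X, f =1 g} -> f =1 g.
Proof.
move=> sX fg v; have : v \in <<X>>%VS by rewrite sX memvf.
move=> /(@coord_span _ _ _ (in_tuple X)) ->; rewrite !linear_sum.
by apply: eq_bigr => i _; rewrite !linearZ_LR fg // mem_nth.
Qed.

(** [linfun] is built from the images of coordinate vectors, hence it respects pointwise equality of
    bare functions; this allows rewriting in the body of [ptrace]. *)
Lemma eq_linfun (V W : vectType C) (f g : V -> W) :
  f =1 g -> linfun f = linfun g.
Proof.
move=> fg; rewrite unlock; congr Hom.
by apply/matrixP => i j; rewrite !mxE /= fg.
Qed.

Lemma prodv_span_sub (A : falgType C) (X Y : seq A) :
  (<<X>> * <<Y>> <= <<[seq (x * y)%R | x <- X, y <- Y]>>)%VS.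
Proof.
apply/prodvP => u v /(@coord_span _ _ _ (in_tuple X)) ->.
move=> /(@coord_span _ _ _ (in_tuple Y)) ->.
rewrite mulr_suml memv_suml // => i _; rewrite mulr_sumr memv_suml // => j _.
rewrite -scalerAl -scalerAr !memvZ // memv_span //.
by apply: allpairs_f; rewrite mem_nth.
Qed.

(** [agenv] is a sum of powers of the span of [gs], and the n-th power is spanned by the words of
    length n, which arise from 1 by left multiplications by generators. *)
Lemma agenv_full_ind (A : falgType C) (gs : seq A) (P : A -> Prop) :
  agenv <<gs>> = fullv -> P 1 ->
  (forall c x y, P x -> P y -> P (c *: x + y)) ->
  (forall g x, g \in gs -> P x -> P (g * x)) -> forall x, P x.
Proof.
move=> gen P1 Plin Pgs.
have P0 : P 0 by rewrite -(addNr 1) -scaleN1r; apply: Plin.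
have Psum n (F : 'I_n -> A) : (forall i, P (F i)) -> P (\sum_i F i).
  by move=> PF; elim/big_ind: _ => // x y Px Py; rewrite -[x]scale1r; apply: Plin.
have Pspan X x : {in X, forall y, P y} -> x \in <<X>>%VS -> P x.
  move=> PX /(@coord_span _ _ _ (in_tuple X)) ->; apply: Psum => i.
  by rewrite -[_ *: _]addr0; apply: Plin => //; apply/PX/mem_nth.
pose words := fix words n := if n is n'.+1 then
  [seq g * w | g <- gs, w <- words n'] else [:: 1].
have Pwords n : {in words n, forall y, P y}.
  elim: n => [|n IHn] y; first by rewrite inE => /eqP ->.
  by move=> /allpairsP[[g w] /= [gs_g nw ->]]; apply: Pgs (IHn _ nw).
have words_span n : (<<gs>> ^+ n <= <<words n>>)%VS.
  elim: n => [|n IHn]; first by rewrite expv0 span_seq1.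
  rewrite expvSl; apply: subv_trans (prodvS (subvv _) IHn) _.
  exact: prodv_span_sub.
move=> x; have := memvf x; rewrite -gen => /memv_sumP[v vP ->].
by apply: Psum => i; apply: Pspan (Pwords i) _; rewrite (subvP (words_span i)) ?vP.
Qed.

Lemma mxtrace_basis_indep (V : vectType C) (e e' : (\dim {:V}).-tuple V)
    (f : 'End(V)) : basis_of {:V} e -> basis_of {:V} e' ->
  \tr (passmx.mxof e e f) = \tr (passmx.mxof e' e' f).
Proof.
move=> be be'.
have -> : passmx.mxof e e f = passmx.mxof e e' \1 *m passmx.mxof e' e' f
    *m passmx.mxof e' e \1.
  by rewrite -!passmx.mxof_comp // comp_lfun1l comp_lfun1r.
rewrite mxtrace_mulC mulmxA -passmx.mxof_comp // comp_lfun1l.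
by rewrite passmx.mxof1 ?mul1mx // (basis_free be').
Qed.

End LinearAlgebra.

(** * Module maps, projectivity of the regular module, and traces *)

Section FdMod.
Variables (C : fieldType) (A : falgType C).

Lemma actMv (M : fdmod A) x y v : act M (x * y) v = act M x (act M y v).
Proof. by rewrite actM comp_lfunE. Qed.

Lemma act1v (M : fdmod A) v : act M 1 v = v.
Proof. by rewrite act1 id_lfunE. Qed.

Lemma actXSv (M : fdmod A) x n v : act M (x ^+ n.+1) v = act M x (act M (x ^+ n) v).
Proof. by rewrite exprS actMv. Qed.

Lemma actDv (M : fdmod A) x y v : act M (x + y) v = act M x v + act M y v.
Proof. by rewrite linearD add_lfunE. Qed.

Lemma actZv (M : fdmod A) c x v : act M (c *: x) v = c *: act M x v.
Proof. by rewrite linearZ_LR scale_lfunE. Qed.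

Lemma act_regE x y : act (regular A) x y = x * y.
Proof. by rewrite lfunE. Qed.

Lemma mod_hom_gen (gs : seq A) (M N : fdmod A) (f : 'Hom(M, N)) :
  agenv <<gs>> = fullv ->
  (forall g v, g \in gs -> f (act M g v) = act N g (f v)) -> mod_hom f.
Proof.
move=> gen fg.
apply: (agenv_full_ind gen) => [v|c x y fx fy v|g x gs_g fx v].
- by rewrite !act1v.
- by rewrite !actDv !actZv linearD linearZ_LR /= fx fy.
- by rewrite !actMv fg // fx.
Qed.

Lemma mod_hom_comp (M N L : fdmod A) (g : 'Hom(N, L)) (f : 'Hom(M, N)) :
  mod_hom g -> mod_hom f -> mod_hom (g \o f)%VF.
Proof. by move=> hg hf x v; rewrite !comp_lfunE hf hg. Qed.

Lemma mod_hom_amulr a : mod_hom (M := regular A) (N := regular A) (amulr a).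
Proof. by move=> x v; rewrite !act_regE !lfunE /= mulrA. Qed.

Lemma mod_hom_regular (f : 'End(regular A)) : mod_hom f -> f = amulr (f 1).
Proof.
move=> hf; apply/lfunP => x; rewrite lfunE /= -[x in LHS]mulr1.
by rewrite -act_regE hf act_regE.
Qed.

Lemma surj_inv (V W : vectType C) (g : 'Hom(V, W)) :
  (forall y, exists x, g x = y) -> forall y, g (g^-1%VF y) = y.
Proof.
by move=> gS y; rewrite limg_lfunVK //; have [x <-] := gS y; rewrite memv_img ?memvf.
Qed.

Lemma regular_projective : projective (regular A).
Proof.
move=> M N g f hg hf gS.
(* The regular module is free on 1, so a preimage of [f 1] determines the lift. *)
pose m := (g^-1 (f 1))%VF.
have h_lin : linear (fun x : A => act M x m).
  by move=> c x y; rewrite linearP add_lfunE scale_lfunE.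
pose mm := GRing.isSemilinear.Build C A M _ _ (GRing.semilinear_linear h_lin).
pose hl : {linear A -> M} := HB.pack (fun x : A => act M x m) mm.
exists (linfun hl); split=> [x v|]; first by rewrite !lfunE /= actMv.
apply/lfunP => x; rewrite comp_lfunE lfunE /= hg surj_inv // -hf.
by rewrite act_regE mulr1.
Qed.

Lemma retract_projective (P Q : fdmod A) (i : 'Hom(Q, P)) (r : 'Hom(P, Q)) :
  mod_hom i -> mod_hom r -> (r \o i)%VF = \1%VF -> projective P -> projective Q.
Proof.
move=> hi hr ri1 pP M N g f hg hf gS.
have [h [hh gh]] := pP M N g (f \o r)%VF hg (mod_hom_comp hf hr) gS.
exists (h \o i)%VF; split; first exact: mod_hom_comp.
by rewrite comp_lfunA gh -comp_lfunA ri1 comp_lfun1r.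
Qed.

Lemma is_traceE (t : forall M : fdmod A, 'End(M) -> C) : is_trace t ->
  forall (c : C) a b, trace_slf t (c *: a + b) = c * trace_slf t a + trace_slf t b.
Proof.
move=> [tL _] c a b; rewrite /trace_slf linearP; apply: tL.
- exact: regular_projective.
- exact: mod_hom_amulr.
- exact: mod_hom_amulr.
Qed.

Lemma trace_slfZ (t : forall M : fdmod A, 'End(M) -> C) : is_trace t ->
  forall c a, trace_slf t (c *: a) = c * trace_slf t a.
Proof.
move=> tr_t c a; have t0 : trace_slf t 0 = 0.
  have := is_traceE tr_t 1 0 0; rewrite scale1r addr0 mul1r => /eqP.
  by rewrite -subr_eq0 opprD addNKr oppr_eq0 => /eqP.
by have := is_traceE tr_t c a 0; rewrite t0 !addr0.
Qed.

Lemma trace_slf_sum (t : forall M : fdmod A, 'End(M) -> C) : is_trace t ->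
  forall n (f : 'I_n -> A),
  trace_slf t (\sum_(i < n) f i) = \sum_(i < n) trace_slf t (f i).
Proof.
move=> tr_t n f; apply: (big_morph _ (op1 := +%R)) => [x y|].
  by rewrite -[x in LHS]scale1r is_traceE // mul1r.
by rewrite -(scale0r (0 : A)) trace_slfZ // mul0r.
Qed.

End FdMod.

(** * Slices of a tensor product and partial traces *)

Section TensorSlices.
Variable C : fieldType.

Lemma pureDl (V W : vectType C) (u v : V) (w : W) :
  pure (u + v) w = pure u w + pure v w.
Proof. by have := (pure_bilin V W).1 w 1 u v; rewrite /= !scale1r. Qed.

Lemma pureDr (V W : vectType C) (u : V) (v w : W) :
  pure u (v + w) = pure u v + pure u w.
Proof. by have := (pure_bilin V W).2 u 1 v w; rewrite /= !scale1r. Qed.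

Lemma pureZl (V W : vectType C) c (u : V) (w : W) :
  pure (c *: u) w = c *: pure u w.
Proof. by apply/matrixP=> i j; rewrite !mxE linearZ_LR /= mulrA. Qed.

Lemma pureZr (V W : vectType C) c (u : V) (w : W) :
  pure u (c *: w) = c *: pure u w.
Proof. by apply/matrixP=> i j; rewrite !mxE linearZ_LR /= mulrCA. Qed.

HB.instance Definition _ (V W : vectType C) (u : V) :=
  GRing.isSemilinear.Build C W (tensor V W) _ (@pure C V W u)
    (GRing.semilinear_linear ((pure_bilin V W).2 u)).

Definition slice (V W : vectType C) (xi : {scalar W}) : tensor V W -> V :=
  tlift (fun v w => xi w *: v).

HB.instance Definition _ (V W : vectType C) (xi : {scalar W}) :=
  GRing.Linear.copy (slice xi) (tlift (fun (v : V) w => xi w *: v)).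

Lemma slice_pure (V W : vectType C) (xi : {scalar W}) (v : V) (w : W) :
  slice xi (pure v w) = xi w *: v.
Proof.
rewrite /slice tlift_pure //; split=> [b c x y | x c a b].
  by rewrite scalerDr !scalerA mulrC.
by rewrite linearP /= scalerDl scalerA.
Qed.

Lemma slice_tmap (V W V' W' : vectType C) (f : 'Hom(V, V')) (g : 'Hom(W, W'))
    (xi : {scalar W'}) (xi' : {scalar W}) c z :
  (forall w, xi (g w) = c * xi' w) ->
  slice xi (tmap f g z) = c *: f (slice xi' z).
Proof.
move=> xig; move: z.
apply: (tensor_ext (f := slice xi \o tmap f g)
  (g := GRing.scale c \o (f \o slice xi'))) => v w /=.
by rewrite tmap_pure !slice_pure xig linearZ scalerA.
Qed.

(** When [M w] is [f (pure u w)], this is the value at [u] of the partial trace of [f] over the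
    second factor. *)
Definition partial_tr (V W : vectType C) (M : W -> tensor V W) : V :=
  \sum_(i < \dim {:W}) slice (coord (vbasis {:W}) i) (M (vbasis {:W})`_i).

Lemma eq_partial_tr (V W : vectType C) (M M' : W -> tensor V W) :
  M =1 M' -> partial_tr M = partial_tr M'.
Proof. by move=> eqM; apply: eq_bigr => i _; rewrite eqM. Qed.

Lemma partial_trD (V W : vectType C) (M M' : W -> tensor V W) :
  partial_tr (fun w => M w + M' w) = partial_tr M + partial_tr M'.
Proof. by rewrite -big_split; apply: eq_bigr => i _; rewrite linearD. Qed.

Lemma partial_trN (V W : vectType C) (M : W -> tensor V W) :
  partial_tr (fun w => - M w) = - partial_tr M.
Proof. by rewrite -sumrN; apply: eq_bigr => i _; rewrite linearN. Qed.

(** Cyclicity of the trace over [W]: expanded in matrix coefficients of [g], the double sum can be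
    read with [g] acting on the argument instead of the value. *)
Lemma partial_tr_tmap (V W V' : vectType C) (f : 'Hom(V, V')) (g : 'End(W))
    (M : {linear W -> tensor V W}) :
  partial_tr (fun w => tmap f g (M w)) = f (partial_tr (fun w => M (g w))).
Proof.
rewrite /partial_tr linear_sum; set e := vbasis _.
have be : basis_of {:W} e := vbasisP _.
have slice_g i z : slice (coord e i) (tmap f g z) =
    \sum_(k < \dim {:W}) coord e i (g e`_k) *: f (slice (coord e k) z).
  move: z; pose rhs (z : tensor V W) : V' :=
    \sum_(k < \dim {:W}) coord e i (g e`_k) *: f (slice (coord e k) z).
  have rhs_lin : linear rhs.
    move=> c s t; rewrite /rhs scaler_sumr -big_split; apply: eq_bigr => k _ /=.
    have := linearP (f \o slice (coord e k)) c s t => /= ->.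
    by rewrite scalerDr !scalerA mulrC.
  pose m := GRing.isSemilinear.Build C _ _ _ _ (GRing.semilinear_linear rhs_lin).
  pose rl : {linear tensor V W -> V'} := HB.pack rhs m.
  apply: (tensor_ext (f := slice (coord e i) \o tmap f g) (g := rl)) => v w /=.
  rewrite tmap_pure slice_pure /rhs.
  rewrite [in LHS](coord_basis be (memvf w)) !linear_sum scaler_suml.
  apply: eq_bigr => k _; rewrite slice_pure.
  rewrite (linearZ_LR f) /= (linearZ_LR g) (linearZ_LR (coord e i)) /=.
  by rewrite scalerA mulrC.
under eq_bigr do rewrite slice_g.
rewrite exchange_big; apply: eq_bigr => k _ /=.
pose L : {linear W -> V'} := f \o slice (coord e k) \o M.
rewrite -[RHS]/(L (g e`_k)) [in RHS](coord_basis be (memvf (g e`_k))) linear_sum.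
by apply: eq_bigr => i _; rewrite linearZ_LR.
Qed.

End TensorSlices.

(** * Characters and matrix coefficients in bases of weight vectors *)

Section Characters.
Import passmx.
Variables (C : fieldType) (A : falgType C).

Lemma mchar_basisE (M : fdmod A) s (v : s.-tuple M) x :
  basis_of {:M} v -> mchar M x = \sum_(i < s) coord v i (act M x v`_i).
Proof.
move=> bv; have dimM : s = \dim {:M} by rewrite (size_basis bv).
move: v bv; rewrite dimM => v bv.
rewrite /mchar (mxtrace_basis_indep _ (vbasisP _) bv).
by apply: eq_bigr => i _; rewrite !mxE /= vecof_delta.
Qed.

Lemma mcharP (M : fdmod A) c x y :
  mchar M (c *: x + y) = c * mchar M x + mchar M y.
Proof. by rewrite /mchar linearP (linearP (mxof _ _)) mxtraceD mxtraceZ. Qed.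

Lemma HmatP p s (P : based_mod A p s) c x y :
  Hmat P (c *: x + y) = c *: Hmat P x + Hmat P y.
Proof. by apply/matrixP => l i; rewrite !mxE actDv actZv linearP. Qed.

Lemma GformP p (P : bool -> forall s, based_mod A p s) s c x y :
  Gform P s (c *: x + y) = c * Gform P s x + Gform P s y.
Proof.
by rewrite /Gform !HmatP !mxtraceD !mxtraceZ mulrDr addrACA.
Qed.

Section Weights.
Variables (M : fdmod A) (K : A) (n : nat) (e : n.-tuple M).
Hypothesis e_basis : basis_of {:M} e.
Hypothesis e_weight : forall u, u \in tval e -> exists c, act M K u = c *: u.

(** In a basis of weight vectors [K] is diagonal, so each coordinate form is an eigenvector of its
    transpose. *)
Lemma coord_weight (i : 'I_n) k w :
  act M K e`_i = k *: e`_i -> coord e i (act M K w) = k * coord e i w.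
Proof.
move=> Ke; have ce (j : 'I_n) : coord e i (act M K e`_j) = k * (j == i)%:R.
  have [->|ji] := eqVneq j i.
    by rewrite Ke linearZ_LR /= coord_free ?(basis_free e_basis) ?eqxx.
  have := e_weight (mem_tnth j e); rewrite (tnth_nth 0) => -[c ->].
  rewrite linearZ_LR /= coord_free ?(basis_free e_basis) // mulr0.
  by rewrite (negPf ji) mulr0.
rewrite {1}(coord_basis e_basis (memvf w)) !linear_sum (bigD1 i) //= big1.
  by rewrite addr0 !linearZ_LR /= ce eqxx mulr1 mulrC.
by move=> j ji; rewrite !linearZ_LR /= ce (negPf ji) !mulr0.
Qed.

(** [x] multiplies the weight of [u] by [c], so [x u] has no component along a basis vector of the
    weight of [u] itself. This makes the characters vanish on monomials with different exponents of
    [F] and [E]. *)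
Lemma weight_coord0 (i : 'I_n) k u x c :
  act M K e`_i = k *: e`_i -> act M K u = k *: u -> k != 0 ->
  K * x = c *: (x * K) -> c != 1 -> coord e i (act M x u) = 0.
Proof.
move=> Ke Ku k0 Kx c1; have := coord_weight (act M x u) Ke.
rewrite -actMv Kx actZv actMv Ku !linearZ_LR /= => /eqP.
rewrite mulrCA -subr_eq0 -mulrBr -{2}[coord _ _ _]mul1r -mulrBl !mulf_eq0.
by rewrite (negPf k0) subr_eq0 (negPf c1) => /eqP.
Qed.

End Weights.

End Characters.

(** * The restricted quantum group *)

Section RestrictedQuantumGroup.
Variables (C : fieldType) (p : nat) (q : C) (U : hopfAlg C) (E F K : U).
Hypotheses (p_gt1 : (1 < p)%N) (q_prim : (2 * p).-primitive_root q).
Hypothesis Uq : is_Uqsl2 p q E F K.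

Lemma p_gt0 : (0 < p)%N. Proof. exact: ltnW. Qed.

Lemma q_neq0 : q != 0.
Proof.
apply/eqP => q0; have := prim_expr_order q_prim.
by rewrite q0 expr0n muln_eq0 /= (gtn_eqF p_gt0) => /eqP; rewrite eq_sym oner_eq0.
Qed.

Lemma q_expr_p : q ^+ p = -1.
Proof.
have : (q ^+ p) ^+ 2 = 1 by rewrite -exprM mulnC (prim_expr_order q_prim).
move/eqP; rewrite sqrf_eq1 => /orP[|/eqP //].
rewrite -(prim_order_dvd q_prim) => /dvdn_leq => /(_ p_gt0).
by rewrite leqNgt -{1}[p]mul1n ltn_pmul2r ?p_gt0.
Qed.

Lemma q_exprpB s : (s <= p)%N -> q ^+ (p - s) = - q ^- s.
Proof.
move=> sp; apply: (mulfI (_ : q ^+ s != 0)); first by rewrite expf_neq0 ?q_neq0.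
by rewrite -exprD subnKC // q_expr_p mulrN mulfV ?expf_neq0 ?q_neq0.
Qed.

Lemma q_expr_eq1 n : (q ^+ n == 1) = (2 * p %| n)%N.
Proof. by rewrite (prim_order_dvd q_prim). Qed.

Lemma q2_expr_neq1 n : (0 < n < p)%N -> q ^+ (2 * n) != 1.
Proof.
case/andP=> n_gt0 n_lt; rewrite q_expr_eq1 dvdn_pmul2l //.
by apply/negP => /dvdn_leq => /(_ n_gt0); rewrite leqNgt n_lt.
Qed.

Lemma q_subV_neq0 n : (0 < n < p)%N -> q ^+ n - q ^- n != 0.
Proof.
move=> np; rewrite subr_eq0; apply/eqP => qn; have /eqP := q2_expr_neq1 np.
by case; rewrite mul2n -addnn exprD {1}qn mulVf // expf_neq0 ?q_neq0.
Qed.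

Lemma q_sub_neq0 : q - q^-1 != 0.
Proof. exact: (@q_subV_neq0 1). Qed.

Lemma q_exprzB m n : q ^ (m%:Z - n%:Z) = q ^+ m * q ^- n.
Proof. by rewrite expfzDr ?q_neq0 // exprnN. Qed.

Lemma qint0 : qint q 0 = 0.
Proof. by rewrite /qint expr0 invr1 subrr mul0r. Qed.

Lemma q2_sub1_neq0 : q * q - 1 != 0.
Proof. by rewrite subr_eq0 -expr2 (q2_expr_neq1 (n := 1)). Qed.

Lemma qint_neq0 n : (0 < n < p)%N -> qint q n != 0.
Proof. by move=> np; rewrite mulf_neq0 ?invr_eq0 ?q_sub_neq0 ?q_subV_neq0. Qed.

Lemma two_p_neq0 : (2 * p)%:R != 0 :> C.
Proof. exact: prim_root_natf_neq0 q_prim. Qed.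

Lemma K_unit : K \is a GRing.unit.
Proof.
have := uq_K2p Uq; case: (2 * p)%N (prim_order_gt0 q_prim) => // n _ Kn.
by apply/unitrP; exists (K ^+ n); rewrite -exprS -exprSr.
Qed.

Lemma K_inv : K^-1 = K ^+ (2 * p).-1.
Proof.
apply: (mulrI K_unit); rewrite mulrV ?K_unit // -exprS.
by rewrite prednK ?(uq_K2p Uq) ?(prim_order_gt0 q_prim).
Qed.

Lemma uq_ind (P : U -> Prop) : P 1 ->
  (forall c x y, P x -> P y -> P (c *: x + y)) ->
  (forall x, P x -> P (E * x)) -> (forall x, P x -> P (F * x)) ->
  (forall x, P x -> P (K * x)) -> forall x, P x.
Proof.
move=> P1 Plin PE PF PK; apply: (agenv_full_ind (uq_gen Uq)) => // g x.
by rewrite !inE => /or3P[] /eqP ->; [apply: PE|apply: PF|apply: PK].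
Qed.

Lemma uq_mod_hom (M N : fdmod U) (f : 'Hom(M, N)) :
  (forall v, f (act M E v) = act N E (f v)) ->
  (forall v, f (act M F v) = act N F (f v)) ->
  (forall v, f (act M K v) = act N K (f v)) -> mod_hom f.
Proof.
move=> fE fF fK; apply: (mod_hom_gen (uq_gen Uq)) => g v.
by rewrite !inE => /or3P[] /eqP ->.
Qed.

Lemma KX_E n : K ^+ n * E = q ^+ (2 * n) *: (E * K ^+ n).
Proof.
elim: n => [|n IHn]; first by rewrite muln0 !expr0 scale1r mul1r mulr1.
rewrite [K ^+ _]exprSr -mulrA (uq_KE Uq) -scalerAr [in LHS]mulrA IHn -scalerAl scalerA.
by rewrite -exprD -mulrA mulnS.
Qed.

Lemma KX_F n : K ^+ n * F = q ^- (2 * n) *: (F * K ^+ n).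
Proof.
elim: n => [|n IHn]; first by rewrite muln0 !expr0 invr1 scale1r mul1r mulr1.
rewrite [K ^+ _]exprSr -mulrA (uq_KF Uq) -scalerAr [in LHS]mulrA IHn -scalerAl scalerA.
by rewrite -invfM -exprD -mulrA mulnS addnC.
Qed.

Lemma Kp_E : K ^+ p * E = E * K ^+ p.
Proof. by rewrite KX_E (prim_expr_order q_prim) scale1r. Qed.

Lemma Kp_F : K ^+ p * F = F * K ^+ p.
Proof. by rewrite KX_F (prim_expr_order q_prim) invr1 scale1r. Qed.

Section TensorAction.
Variables M N : fdmod U.

Let tact_bilin : bilin (fun a b => tmap (act M a) (act N b)).
Proof.
by split=> [b c a a' | a c b b']; apply/lfunP; apply: tensor_ext => v w;
  rewrite [RHS]add_lfunE scale_lfunE !tmap_pure;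
  rewrite [LHS]tmap_pure actDv actZv ?pureDl ?pureDr ?pureZl ?pureZr.
Qed.

Lemma act_tensorE z :
  act (tensor_mod M N) E z = tmap \1%VF (act N E) z + tmap (act M E) (act N K) z.
Proof.
rewrite /= /tensor_act (uq_copE Uq) linearD /= !tlift_pure ?add_lfunE ?act1 //.
Qed.

Lemma act_tensorF z :
  act (tensor_mod M N) F z = tmap (act M F) \1%VF z + tmap (act M K^-1) (act N F) z.
Proof.
rewrite /= /tensor_act (uq_copF Uq) linearD /= !tlift_pure ?add_lfunE ?act1 //.
Qed.

Lemma act_tensorK z : act (tensor_mod M N) K z = tmap (act M K) (act N K) z.
Proof. by rewrite /= /tensor_act (uq_copK Uq) tlift_pure. Qed.

Lemma act_tensor_pureE u v : act (tensor_mod M N) E (pure u v) =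
  pure u (act N E v) + pure (act M E u) (act N K v).
Proof. by rewrite act_tensorE !tmap_pure id_lfunE. Qed.

Lemma act_tensor_pureF u v : act (tensor_mod M N) F (pure u v) =
  pure (act M F u) v + pure (act M K^-1 u) (act N F v).
Proof. by rewrite act_tensorF !tmap_pure id_lfunE. Qed.

Lemma act_tensor_pureK u v : act (tensor_mod M N) K (pure u v) =
  pure (act M K u) (act N K v).
Proof. by rewrite act_tensorK !tmap_pure. Qed.

(** This and the next two lemmas solve the coproduct formulas for the term with the generator on the
    first factor, trading it for the action on the tensor product, which module maps respect. *)
Lemma pure_actE u v : pure (act M E u) v =
  act (tensor_mod M N) E (pure u (act N K^-1 v)) - pure u (act N (E * K^-1) v).
Proof.
by rewrite act_tensor_pureE -!actMv mulrV ?K_unit // act1v addrAC subrr add0r.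
Qed.

Lemma pure_actF u v : pure (act M F u) v =
  act (tensor_mod M N) F (pure u v) - pure (act M K^-1 u) (act N F v).
Proof. by rewrite act_tensor_pureF addrK. Qed.

Lemma pure_actK u v : pure (act M K u) v =
  act (tensor_mod M N) K (pure u (act N K^-1 v)).
Proof. by rewrite act_tensor_pureK -!actMv mulrV ?K_unit // act1v. Qed.

End TensorAction.

(** * The modified trace on the monomials *)

Section PivotalPartialTrace.
Variables (M V : fdmod U) (f : 'End(tensor_mod M V)).
Hypothesis f_hom : mod_hom f.

(** The partial trace of [f] over [V] with a twist [b] acting on the input. The rules [N_K], [N_E],
    [N_F] pull a generator out of [u] at the price of changing the twist. *)
Let N (u : M) (b : U) : M := partial_tr (fun v => f (pure u (act V b v))).

Let lin u (a : 'End(V)) : {linear V -> tensor M V} := f \o @pure C M V u \o a.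

Let N_K u b : N (act M K u) b = act M K (N u (K^-1 * b * K)).
Proof.
rewrite /N.
have -> : partial_tr (fun v => f (pure (act M K u) (act V b v))) =
    partial_tr (fun v => tmap (act M K) (act V K) (lin u (act V (K^-1 * b)) v)).
  by apply: eq_partial_tr => v /=; rewrite pure_actK f_hom act_tensorK -!actMv.
by rewrite partial_tr_tmap /=; congr (act M K _); apply: eq_partial_tr => v; rewrite -actMv.
Qed.


Let N_E u b : N (act M E u) b =
  act M E (N u (K^-1 * b * K)) + N u (K^-1 * b * E) - N u (E * K^-1 * b).
Proof.
rewrite /N.
have -> : partial_tr (fun v => f (pure (act M E u) (act V b v))) =
    partial_tr (fun v => tmap \1%VF (act V E) (lin u (act V (K^-1 * b)) v))
    + partial_tr (fun v => tmap (act M E) (act V K) (lin u (act V (K^-1 * b)) v))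
    - partial_tr (fun v => f (pure u (act V (E * K^-1 * b) v))).
  rewrite -partial_trN -!partial_trD; apply: eq_partial_tr => v /=.
  by rewrite pure_actE linearB /= f_hom act_tensorE -!actMv.
rewrite !partial_tr_tmap id_lfunE /= [X in X - _]addrC; congr (act M E _ + _ - _);
  by apply: eq_partial_tr => v; rewrite -!actMv.
Qed.


Let N_F u b : N (act M F u) b =
  act M F (N u b) + act M K^-1 (N u (b * F)) - N (act M K^-1 u) (F * b).
Proof.
rewrite /N.
have -> : partial_tr (fun v => f (pure (act M F u) (act V b v))) =
    partial_tr (fun v => tmap (act M F) \1%VF (lin u (act V b) v))
    + partial_tr (fun v => tmap (act M K^-1) (act V F) (lin u (act V b) v))
    - partial_tr (fun v => f (pure (act M K^-1 u) (act V (F * b) v))).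
  rewrite -partial_trN -!partial_trD; apply: eq_partial_tr => v /=.
  by rewrite pure_actF linearB /= f_hom act_tensorF -!actMv.
rewrite !partial_tr_tmap /=; congr (act M F _ + act M K^-1 _ - _);
  by apply: eq_partial_tr => v; rewrite ?id_lfunE -?actMv.
Qed.


(** By cyclicity over [V], the pivotal element may act before [f] instead of after it. *)
Lemma ptraceE u : ptrace (K ^+ (p + 1)) f u =
  partial_tr (fun v => f (pure u (act V (K ^+ (p + 1)) v))).
Proof.
have pt u' : \sum_(i < \dim {:V}) tlift (fun u v => coord (vbasis {:V}) i v *: u)
      (tmap \1%VF (act V (K ^+ (p + 1))) (f (pure u' (vbasis {:V})`_i))) =
    partial_tr (fun v => f (pure u' (act V (K ^+ (p + 1)) v))).
  transitivity (partial_tr (fun v => tmap \1%VF (act V (K ^+ (p + 1))) (lin u' \1 v))).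
    by apply: eq_bigr => i _; rewrite /= id_lfunE.
  by rewrite partial_tr_tmap id_lfunE; apply: eq_partial_tr => v /=; rewrite id_lfunE.
have N_lin : linear (fun u => N u (K ^+ (p + 1))).
  move=> c u1 u2; rewrite /N /partial_tr scaler_sumr -big_split.
  apply: eq_bigr => i _ /=; set xi := coord _ i.
  by rewrite pureDl pureZl (linearP f) (linearP (slice xi)).
pose m := GRing.isSemilinear.Build C M M _ _ (GRing.semilinear_linear N_lin).
pose Nl : {linear M -> M} := HB.pack (fun u => N u (K ^+ (p + 1))) m.
have -> : ptrace (K ^+ (p + 1)) f = linfun Nl.
  by apply: eq_linfun => v; rewrite pt.
by rewrite lfunE.
Qed.

(** For the twist [b = K^(p+1)] the correction terms in [N_E] and [N_F] cancel: [b] commutes with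
    [K], and [K^-1 b = K^p] commutes with [E] and [F]. *)
Lemma ptrace_hom : mod_hom (ptrace (K ^+ (p + 1)) f).
Proof.
have KV1 : K^-1 * K ^+ (p + 1) = K ^+ p.
  by rewrite addn1 exprS mulKr ?K_unit.
have KK : K^-1 * K ^+ (p + 1) * K = K ^+ (p + 1) by rewrite KV1 addn1 exprSr.
apply: uq_mod_hom => v; rewrite !ptraceE -/(N _ _) -/(N _ _).
- rewrite N_E KK KV1 Kp_E -mulrA KV1 addrK //.
- have N_KV b u : N (act M K^-1 u) b = act M K^-1 (N u (K * b * K^-1)).
    rewrite -[u in RHS](act1v) -(mulrV K_unit) [in RHS]actMv N_K -actMv.
    rewrite mulVr ?K_unit // act1v; congr (N _ _).
    by rewrite -!mulrA mulVr ?K_unit // mulr1 mulKr ?K_unit.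
  suff gF : K * (F * K ^+ (p + 1)) * K^-1 = K ^+ (p + 1) * F.
    by rewrite N_F N_KV gF addrK.
  by rewrite addn1 [in LHS]exprSr !mulrA mulrK ?K_unit // -mulrA -Kp_F mulrA exprS.
by rewrite N_K KK.
Qed.

End PivotalPartialTrace.

(** * The tensor product of the regular module with a module *)

Section RegularTensor.
Local Arguments tensor_mod : simpl never.
Local Arguments regular : simpl never.
Variable V : fdmod U.
Local Notation R := (regular U).
Local Notation T := (tensor_mod R V).

Lemma linear_act_pure (v : V) : linear (fun x : U => act T x (pure (1 : U) v)).
Proof. by move=> c x y; rewrite actDv actZv. Qed.

(* An isomorphism of U (x) V, with U acting on the left factor only, onto the
   tensor product module. *)
Definition free_tensor : 'End(T) :=
  linfun (tlift (fun (x : U) (v : V) => act T x (pure (1 : U) v))).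
Local Notation Phi := free_tensor.

Lemma free_tensor_pure x v : Phi (pure x v) = act T x (pure (1 : U) v).
Proof.
rewrite lfunE /= tlift_pure //; split=> [w|y]; first exact: linear_act_pure.
by move=> c w w'; rewrite pureDr pureZr linearD linearZ_LR.
Qed.

Lemma free_tensor_act y z : Phi (tmap (amull y) \1%VF z) = act T y (Phi z).
Proof.
move: z; apply: (tensor_ext (f := Phi \o tmap (amull y) \1%VF)
  (g := act T y \o Phi)) => x v /=.
rewrite tmap_pure !free_tensor_pure id_lfunE [amull y x]lfunE.
by rewrite actMv.
Qed.

(** The image is a submodule containing all [1 (x) v]. Through [pure_actE], [pure_actF] and
    [pure_actK], the property that [x (x) v] lies in it for every [v] passes from [x] to [E x],
    [F x] and [K x]. Injectivity follows by dimension, source and target being the same space. *)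
Lemma free_tensor_surj z : z \in limg Phi.
Proof.
have pure_im (x : U) : forall v, pure x v \in limg Phi.
  have im_act y w : w \in limg Phi -> act T y w \in limg Phi.
    by case/memv_imgP => w' _ ->; rewrite -free_tensor_act memv_img ?memvf.
  elim/uq_ind: x => [v|c x y IHx IHy v|x IHx v|x IHx v|x IHx v].
  - by rewrite -[pure _ _](act1v (M := T)) -free_tensor_pure memv_img ?memvf.
  - by rewrite pureDl pureZl memvD ?memvZ.
  - by rewrite -act_regE (pure_actE (M := R)) memvB ?im_act.
  - rewrite -act_regE (pure_actF (M := R)) memvB ?im_act //.
    (* The coproduct of [F] leaves [K^-1] on the first factor; as a power of [K] it is handled by
       induction. *)
    rewrite act_regE K_inv; elim: (2 * p).-1 (act V F v) => [|n IHn] w.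
      by rewrite mul1r.
    by rewrite exprS -mulrA -act_regE (pure_actK (M := R)) im_act.
  - by rewrite -act_regE (pure_actK (M := R)) im_act ?IHx.
have <- : tlift (@pure _ R V) z = z.
  apply: (tensor_ext (f := tlift (@pure _ R V)) (g := idfun)) => x v /=.
  by rewrite tlift_pure //; apply: pure_bilin.
rewrite /tlift memv_suml // => i _; rewrite memv_suml // => j _.
by rewrite memvZ.
Qed.

Lemma free_tensor_lker0 : lker Phi == 0%VS.
Proof.
have := limg_ker_dim Phi fullv; rewrite capfv.
have -> : limg Phi = fullv.
  by apply/vspaceP => z; rewrite free_tensor_surj memvf.
by rewrite -dimv_eq0 => /eqP; rewrite -[X in _ == X]add0n eqn_add2r.
Qed.

Lemma free_tensorK : cancel Phi Phi^-1%VF.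
Proof. exact/lker0_lfunK/free_tensor_lker0. Qed.

Lemma free_tensorVK : cancel Phi^-1%VF Phi.
Proof. exact/lker0_lfunVK/free_tensor_lker0. Qed.

Lemma free_tensorV_act y z :
  (Phi^-1)%VF (act T y z) = tmap (amull y) \1%VF ((Phi^-1)%VF z).
Proof.
by rewrite -{1}[z]free_tensorVK -free_tensor_act free_tensorK.
Qed.

Lemma regular_tensor_projective : projective T.
Proof.
move=> M N g f hg hf gS.
(* Through [Phi] the module is free on the vectors [1 (x) v]; preimages of their values under [f],
   chosen linearly in [v], define the lift. *)
pose m (v : V) : M := (g^-1 (f (pure (1 : U) v)))%VF.
pose h0 : {linear T -> M} := tlift (fun (x : U) v => act M x (m v)).
have h0_pure (x : U) v : h0 (pure x v) = act M x (m v).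
  rewrite /h0 /= tlift_pure //; split=> [w c y y'|y c w w'].
    by rewrite actDv actZv.
  by rewrite /m pureDr pureZr !linearD !linearZ_LR.
exists (linfun (h0 \o (Phi^-1)%VF)); split=> [y z|].
  rewrite !lfunE /= free_tensorV_act; move: ((Phi^-1)%VF z).
  apply: (tensor_ext (f := h0 \o tmap (amull y) \1%VF) (g := act M y \o h0)).
  by move=> x v /=; rewrite tmap_pure !h0_pure id_lfunE lfunE /= actMv.
apply/lfunP => z; rewrite comp_lfunE lfunE /= -[z in RHS]free_tensorVK.
move: ((Phi^-1)%VF z).
apply: (tensor_ext (f := g \o h0) (g := f \o Phi)) => x v /=.
by rewrite h0_pure hg surj_inv // free_tensor_pure hf.
Qed.

Lemma slice_coordE (xi : {scalar V}) (z : T) :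
  slice xi z = \sum_(i < \dim {:V})
    xi (vbasis {:V})`_i *: slice (coord (vbasis {:V}) i) z.
Proof.
pose rhs (z : tensor U V) : U := \sum_(i < \dim {:V})
    xi (vbasis {:V})`_i *: slice (coord (vbasis {:V}) i) z.
have rhs_lin : linear rhs.
  move=> c s t; rewrite /rhs scaler_sumr -big_split; apply: eq_bigr => k _ /=.
  by rewrite (linearP (slice _)) scalerDr !scalerA mulrC.
pose mm := GRing.isSemilinear.Build C _ _ _ _ (GRing.semilinear_linear rhs_lin).
pose rl : {linear tensor U V -> U} := HB.pack rhs mm.
apply: (tensor_ext (f := slice xi) (g := rl)) => x v /=.
rewrite /rhs slice_pure [in LHS](coord_vbasis (memvf v)) linear_sum scaler_suml.
by apply: eq_bigr => i _; rewrite slice_pure linearZ_LR scalerA mulrC.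
Qed.

(** The endomorphism [f] built from [inc], [rho] and [ret] is traced twice: by cyclicity on the
    regular module, and through its partial trace. The eigenform hypothesis turns [xi] composed with
    the pivotal element into [c] times [xi]. *)
Lemma modified_trace_slice (t : forall M : fdmod U, 'End(M) -> C)
    (xi : {scalar V}) (c : C) (v : V) (a : U) :
  is_modified_trace (K ^+ (p + 1)) t ->
  (forall w, xi (act V (K ^+ (p + 1)) w) = c * xi w) ->
  xi v * trace_slf t a =
    c * trace_slf t (slice xi (act T a (pure (1 : U) v)) : U).
Proof.
move=> [tr_t mod_t] xi_g; have [_ tC] := tr_t.
pose mm := GRing.isSemilinear.Build C _ _ _ _
  (GRing.semilinear_linear (linear_act_pure v)).
pose inc_lin : {linear U -> T} :=
  HB.pack (fun x : U => act T x (pure (1 : U) v)) mm.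
pose inc : 'Hom(R, T) := linfun inc_lin.
have incE x : inc x = act T x (pure (1 : U) v) by rewrite lfunE.
pose ret : 'Hom(T, R) := linfun (slice xi \o (Phi^-1)%VF).
have retE z : ret z = slice xi ((Phi^-1)%VF z) by rewrite lfunE.
have inc_hom : mod_hom inc by move=> y x; rewrite !incE act_regE actMv.
have ret_hom : mod_hom ret.
  move=> y z; rewrite !retE free_tensorV_act.
  rewrite (slice_tmap _ (xi' := xi) (c := 1)) ?scale1r // => w.
  by rewrite id_lfunE mul1r.
have ret_pure (x : U) w : ret (act T x (pure (1 : U) w)) = xi w *: x.
  by rewrite retE -free_tensor_pure free_tensorK slice_pure.
pose rho := (@amulr C U a : 'End(R)).
have rho_hom : mod_hom rho := mod_hom_amulr a.
pose f : 'End(T) := (inc \o (rho \o ret))%VF.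
have f_hom : mod_hom f by apply: mod_hom_comp => //; apply: mod_hom_comp.
have t_f : t T f = trace_slf t (xi v *: a).
  rewrite -(tC _ _ (@regular_projective _ _) regular_tensor_projective) //;
    last exact: mod_hom_comp.
  rewrite /trace_slf; congr (t R _); apply/lfunP => x.
  by rewrite !comp_lfunE incE ret_pure !lfunE /= -scalerAl -scalerAr.
have [t_lin _] := tr_t.
rewrite -!(trace_slfZ tr_t).
rewrite -t_f mod_t //; last exact: regular_projective.
(* An endomorphism of the regular module is right multiplication by its value at 1, so the partial
   trace is only needed at 1. *)
rewrite (mod_hom_regular (ptrace_hom f_hom)) -/(trace_slf t _).
congr (trace_slf t _); rewrite ptraceE // slice_coordE scaler_sumr.
apply: eq_bigr => i _.
have f1 w : f (pure (1 : U) w) = xi w *: act T a (pure (1 : U) v).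
  rewrite !comp_lfunE -[pure _ w](act1v (M := T)) ret_pure linearZ linearZ /=.
  by rewrite incE lfunE /= mul1r.
by rewrite f1 xi_g linearZ_LR scalerA.
Qed.

End RegularTensor.

(** * Commutation rules and the spanning monomials *)

Lemma K_FX m : K * F ^+ m = q ^- (2 * m) *: (F ^+ m * K).
Proof.
elim: m => [|m IHm]; first by rewrite muln0 invr1 scale1r mul1r mulr1.
rewrite [F ^+ _]exprSr [in LHS]mulrA IHm -scalerAl -(mulrA _ K) (uq_KF Uq).
by rewrite -scalerAr scalerA -invfM -exprD addnC -mulnS mulrA.
Qed.

Lemma K_EX n : K * E ^+ n = q ^+ (2 * n) *: (E ^+ n * K).
Proof.
elim: n => [|n IHn]; first by rewrite muln0 scale1r mul1r mulr1.
rewrite [E ^+ _]exprSr [in LHS]mulrA IHn -scalerAl -(mulrA _ K) (uq_KE Uq).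
by rewrite -scalerAr scalerA -exprD addnC -mulnS mulrA.
Qed.

Lemma KV_EX n : K^-1 * E ^+ n = q ^- (2 * n) *: (E ^+ n * K^-1).
Proof.
apply: (mulrI K_unit); rewrite mulVKr ?K_unit // -scalerAr mulrA K_EX.
by rewrite -scalerAl scalerA mulVf ?expf_neq0 ?q_neq0 // scale1r mulrK ?K_unit.
Qed.

Lemma K_monomial m n j : K * (F ^+ m * E ^+ n * K ^+ j) =
  (q ^- (2 * m) * q ^+ (2 * n)) *: (F ^+ m * E ^+ n * K ^+ j.+1).
Proof.
rewrite !mulrA K_FX -!scalerAl -(mulrA _ K) K_EX -scalerAr -!scalerAl scalerA.
by rewrite exprS !mulrA.
Qed.

Lemma monomial_ind (P : U -> Prop) :
  (forall c x y, P x -> P y -> P (c *: x + y)) ->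
  (forall m n j, (m < p)%N -> (n < p)%N -> (j < 2 * p)%N ->
     P (F ^+ m * E ^+ n * K ^+ j)) ->
  forall x, P x.
Proof.
move=> Plin Pmono.
(* S is the span of all monomials, without bounds on the exponents. *)
pose lin (Q : U -> Prop) := forall c x y, Q x -> Q y -> Q (c *: x + y).
pose S x := forall Q, lin Q -> (forall m n j, Q (F ^+ m * E ^+ n * K ^+ j)) -> Q x.
have S_mono m n j : S (F ^+ m * E ^+ n * K ^+ j) by move=> Q _; apply.
have S_lin : lin S by move=> c x y Sx Sy Q lQ mQ; apply: (lQ); [apply: Sx|apply: Sy].
have S_mul g : (forall m n j, S (g * (F ^+ m * E ^+ n * K ^+ j))) ->
    forall x, S x -> S (g * x).
  move=> gS x Sx; apply: (Sx (fun y => S (g * y))) => // c y z Sy Sz.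
  by rewrite mulrDr -scalerAr; apply: S_lin.
have S1 : S 1 by have := S_mono 0 0 0; rewrite !mulr1.
have S0 : S 0 by have := S_lin (-1) 1 1 S1 S1; rewrite scaleN1r addNr.
have SZ c x : S x -> S (c *: x) by rewrite -[_ *: _]addr0 => Sx; apply: S_lin.
have SD x y : S x -> S y -> S (x + y) 
  by move=> Sx Sy; rewrite -[x]scale1r; apply: S_lin.
have SK x : S x -> S (K * x).
  by apply: S_mul => m n j; rewrite K_monomial; exact: SZ (S_mono _ _ _).
have SF x : S x -> S (F * x).
  by apply: S_mul => m n j; rewrite !mulrA -(exprS F m); apply: S_mono.
have SKV x : S x -> S (K^-1 * x).
  rewrite K_inv; elim: (2 * p).-1 => [|n IHn] Sx; first by rewrite mul1r.
  by rewrite exprS -mulrA; apply: SK (IHn Sx).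
have SE x : S x -> S (E * x).
  apply: S_mul => m n j; elim: m => [|m IHm].
    by rewrite mul1r mulrA -(exprS E n); have := S_mono 0 n.+1 j; rewrite mul1r.
  (* [E] is moved past one [F] at a time; the commutator only involves [K] and [K^-1], under which
     [S] is already stable. *)
  have -> : E * (F ^+ m.+1 * E ^+ n * K ^+ j) = F * (E * (F ^+ m * E ^+ n * K ^+ j))
      + (q - q^-1)^-1 *: (K * (F ^+ m * E ^+ n * K ^+ j)
        - K^-1 * (F ^+ m * E ^+ n * K ^+ j)).
    by rewrite exprS !mulrA (uq_EF Uq) !mulrDl -!scalerAl !mulrBl.
  apply: SD (SF _ IHm) (SZ _ _ (SD _ _ (SK _ (S_mono _ _ _)) _)).
  rewrite -scaleN1r; exact: SZ (SKV _ (S_mono _ _ _)).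
have allS x : S x.
  exact: (uq_ind S1 S_lin SE SF SK).
move=> x; apply: allS => // m n j.
have P0 : P 0.
  have := Pmono 0 0 0 p_gt0 p_gt0 (prim_order_gt0 q_prim) => P1.
  by have := Plin (-1) _ _ P1 P1; rewrite scaleN1r addNr.
(* Exponents of [F] or [E] beyond the range give 0, covered by [P0]; the exponent of [K] is reduced
   modulo 2p. *)
have [mp|pm] := ltnP m p; last by rewrite -(subnK pm) exprD (uq_Fp Uq) mulr0 !mul0r.
have [np|pn] := ltnP n p; last by rewrite -(subnK pn) exprD (uq_Ep Uq) !mulr0 !mul0r.
rewrite (divn_eq j (2 * p)) exprD mulnC exprM (uq_K2p Uq) expr1n mul1r.
by apply: Pmono; rewrite // ltn_mod (prim_order_gt0 q_prim).
Qed.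

Lemma monomial_ext (f g : {scalar U}) :
  (forall m n j, (m < p)%N -> (n < p)%N -> (j < 2 * p)%N ->
     f (F ^+ m * E ^+ n * K ^+ j) = g (F ^+ m * E ^+ n * K ^+ j)) ->
  f =1 g.
Proof.
by move=> fg; apply: monomial_ind => // c x y fx fy; rewrite !linearP fx fy.
Qed.

(** * Equations for the modified trace from the module X^+(2) *)

Section TwoDimensionalSimple.
Local Arguments tensor_mod : simpl never.
Local Arguments regular : simpl never.
Variables (V : fdmod U) (v : 2.-tuple V).
Hypothesis v_std : is_stdbasis_simple q E F K false v.
Local Notation T := (tensor_mod (regular U) V).

Let xi0 : {scalar V} := coord v ord0.
Let xi1 : {scalar V} := coord v ord_max.
(* An element z of U (x) V is s0 z (x) v_0 + s1 z (x) v_1. *)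
Let s0 (z : T) : U := slice xi0 z.
Let s1 (z : T) : U := slice xi1 z.

Let v_dec w : w = xi0 w *: v`_0 + xi1 w *: v`_1.
Proof.
rewrite {1}(coord_basis (sim_basis v_std) (memvf w)) !big_ord_recl big_ord0 addr0.
by congr (coord v _ w *: _ + coord v _ w *: _); apply: val_inj.
Qed.

Let xi_v : (xi0 v`_0 = 1) * (xi0 v`_1 = 0) * (xi1 v`_0 = 0) * (xi1 v`_1 = 1).
Proof.
have fv := basis_free (sim_basis v_std).
have c i j := @coord_free _ _ _ v i j fv.
by have := (c ord0 ord0, c ord_max ord0, c ord0 ord_max, c ord_max ord_max) => /=.
Qed.

Let K_v0 : act V K v`_0 = q *: v`_0.
Proof. by rewrite (sim_K v_std) // /sgnb mul1r expr1z. Qed.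

Let K_v1 : act V K v`_1 = q^-1 *: v`_1.
Proof. by rewrite (sim_K v_std) // /sgnb mul1r. Qed.

Let E_v1 : act V E v`_1 = v`_0.
Proof.
have q11 : qint q 1 = 1 by rewrite /qint !expr1 mulfV ?q_sub_neq0.
by rewrite (sim_E v_std) // /sgnb !mul1r q11 !mul1r scale1r.
Qed.

Let F_v0 : act V F v`_0 = v`_1. Proof. by rewrite (sim_F v_std). Qed.
Let F_v1 : act V F v`_1 = 0. Proof. exact: (sim_Flast v_std). Qed.

Let xiE (xi : {scalar V}) (x : U) w :
  xi (act V x w) = xi0 w * xi (act V x v`_0) + xi1 w * xi (act V x v`_1).
Proof.
by rewrite {1}[w]v_dec linearD !(linearZ_LR (act V x)) linearD !(linearZ_LR xi).
Qed.

Let xi0K w : xi0 (act V K w) = q * xi0 w.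
Proof. by rewrite xiE K_v0 K_v1 !linearZ_LR /= !xi_v; ring. Qed.
Let xi1K w : xi1 (act V K w) = q^-1 * xi1 w.
Proof. by rewrite xiE K_v0 K_v1 !linearZ_LR /= !xi_v; ring. Qed.
Let xi0E w : xi0 (act V E w) = 1 * xi1 w.
Proof. by rewrite xiE (sim_E0 v_std) E_v1 linear0 !xi_v; ring. Qed.
Let xi1E w : xi1 (act V E w) = 0 * xi1 w.
Proof. by rewrite xiE (sim_E0 v_std) E_v1 linear0 !xi_v; ring. Qed.
Let xi0F w : xi0 (act V F w) = 0 * xi0 w.
Proof. by rewrite xiE F_v0 F_v1 linear0 !xi_v; ring. Qed.
Let xi1F w : xi1 (act V F w) = 1 * xi0 w.
Proof. by rewrite xiE F_v0 F_v1 linear0 !xi_v; ring. Qed.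

Let s0_pure u w : s0 (pure u w) = xi0 w *: u. Proof. exact: slice_pure. Qed.
Let s1_pure u w : s1 (pure u w) = xi1 w *: u. Proof. exact: slice_pure. Qed.

Let s0E z : s0 (act T E z) = s1 z + q *: (E * s0 z).
Proof.
rewrite /s0 act_tensorE linearD /= (slice_tmap _ _ xi0E) (slice_tmap _ _ xi0K).
by rewrite scale1r id_lfunE act_regE.
Qed.

Let s1E z : s1 (act T E z) = q^-1 *: (E * s1 z).
Proof.
rewrite /s1 act_tensorE linearD /= (slice_tmap _ _ xi1E) (slice_tmap _ _ xi1K).
by rewrite scale0r add0r act_regE.
Qed.

Let s0F z : s0 (act T F z) = F * s0 z.
Proof.
rewrite /s0 act_tensorF linearD /= (slice_tmap _ _ xi0F) scale0r addr0.
rewrite (slice_tmap _ (xi' := xi0) (c := 1)) ?scale1r ?act_regE // => w.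
by rewrite id_lfunE mul1r.
Qed.

Let s1F z : s1 (act T F z) = F * s1 z + K^-1 * s0 z.
Proof.
rewrite /s1 act_tensorF linearD /= (slice_tmap _ _ xi1F).
rewrite (slice_tmap _ (xi' := xi1) (c := 1)) ?scale1r ?act_regE // => w.
by rewrite id_lfunE mul1r.
Qed.

Let s0K z : s0 (act T K z) = q *: (K * s0 z).
Proof. by rewrite /s0 act_tensorK (slice_tmap _ _ xi0K) act_regE. Qed.

Let s1K z : s1 (act T K z) = q^-1 *: (K * s1 z).
Proof. by rewrite /s1 act_tensorK (slice_tmap _ _ xi1K) act_regE. Qed.

Let s0KX j z : s0 (act T (K ^+ j) z) = q ^+ j *: (K ^+ j * s0 z).
Proof.
elim: j => [|j IHj]; first by rewrite act1v mul1r scale1r.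
by rewrite actXSv s0K IHj -scalerAr scalerA -exprS mulrA -exprS.
Qed.

Let s1KX j z : s1 (act T (K ^+ j) z) = q ^- j *: (K ^+ j * s1 z).
Proof.
elim: j => [|j IHj]; first by rewrite act1v mul1r invr1 scale1r.
by rewrite actXSv s1K IHj -scalerAr scalerA -invfM -exprS mulrA -exprS.
Qed.

Let s1EX n z : s1 (act T (E ^+ n) z) = q ^- n *: (E ^+ n * s1 z).
Proof.
elim: n => [|n IHn]; first by rewrite act1v mul1r invr1 scale1r.
by rewrite actXSv s1E IHn -scalerAr scalerA -invfM -exprS mulrA -exprS.
Qed.

Let s0EX n z : s1 z = 0 -> s0 (act T (E ^+ n) z) = q ^+ n *: (E ^+ n * s0 z).
Proof.
move=> z1; elim: n => [|n IHn]; first by rewrite act1v mul1r scale1r.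
rewrite actXSv s0E s1EX z1 mulr0 scaler0 add0r IHn -scalerAr scalerA -exprS.
by rewrite mulrA -exprS.
Qed.

(** [E] kills v_0, so exactly one of the n+1 factors acts on [V], taking v_1 to v_0; the powers of q
    from its possible positions add up to [n+1]. *)
Let s0EXS n z : s0 z = 0 ->
  s0 (act T (E ^+ n.+1) z) = qint q n.+1 *: (E ^+ n * s1 z).
Proof.
move=> z0; elim: n => [|n IHn].
  rewrite actXSv s0E act1v z0 mulr0 scaler0 addr0 mul1r.
  by rewrite /qint expr1 mulfV ?q_sub_neq0 ?scale1r.
rewrite actXSv s0E s1EX IHn -scalerAr scalerA (mulrA E) -(exprS E n) -scalerDl.
congr (_ *: _); rewrite /qint [q ^+ n.+2]exprS; field.
by rewrite q_neq0 q2_sub1_neq0 expf_neq0 ?q_neq0.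
Qed.

Let s0FX n z : s0 (act T (F ^+ n) z) = F ^+ n * s0 z.
Proof.
elim: n => [|n IHn]; first by rewrite act1v mul1r.
by rewrite actXSv s0F IHn mulrA -exprS.
Qed.

(** Likewise a single [F] takes v_0 to v_1. Its coproduct puts [K^-1] on the first factor, and
    moving this past the other factors [F] produces the powers of q^2. *)
Let s1FXS n z : s1 z = 0 -> s1 (act T (F ^+ n.+1) z) =
  (\sum_(i < n.+1) q ^+ (2 * i)) *: (F ^+ n * K^-1 * s0 z).
Proof.
move=> z1; elim: n => [|n IHn].
  by rewrite actXSv s1F act1v z1 mulr0 add0r big_ord1 scale1r mul1r.
have KVF : K^-1 * F ^+ n.+1 = q ^+ (2 * n.+1) *: (F ^+ n.+1 * K^-1).
  apply: (mulrI K_unit); rewrite mulVKr ?K_unit // -scalerAr mulrA K_FX.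
  by rewrite -scalerAl scalerA mulfV ?expf_neq0 ?q_neq0 // scale1r mulrK ?K_unit.
rewrite actXSv s1F IHn s0FX [in K^-1 * _]mulrA KVF -scalerAr [in RHS]big_ord_recr scalerDl /=.
by rewrite -scalerAl !mulrA -exprS.
Qed.

Variable t : forall M : fdmod U, 'End(M) -> C.
Arguments t : clear implicits.
Hypothesis t_mod : is_modified_trace (K ^+ (p + 1)) t.
Let phi := trace_slf t.

Let xi0_KX n w : xi0 (act V (K ^+ n) w) = q ^+ n * xi0 w.
Proof.
elim: n => [|n IHn]; first by rewrite act1v mul1r.
by rewrite actXSv xi0K IHn mulrA -exprS.
Qed.

Let xi1_KX n w : xi1 (act V (K ^+ n) w) = q ^- n * xi1 w.
Proof.
elim: n => [|n IHn]; first by rewrite act1v invr1 mul1r.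
by rewrite actXSv xi1K IHn mulrA -invfM -exprS.
Qed.

Let phi_s0 a w : xi0 w * phi a = q ^+ (p + 1) * phi (s0 (act T a (pure (1 : U) w))).
Proof. exact: (modified_trace_slice _ _ t_mod (xi0_KX _)). Qed.

Let phi_s1 a w : xi1 w * phi a = q ^- (p + 1) * phi (s1 (act T a (pure (1 : U) w))).
Proof. exact: (modified_trace_slice _ _ t_mod (xi1_KX _)). Qed.

Let phiZ c a : phi (c *: a) = c * phi a.
Proof. exact: trace_slfZ (proj1 t_mod) c a. Qed.

(** Starting from v_1 and reading off the v_0 component, the left side of [phi_s0] is 0, while one
    extra [E] leaves [n+1], nonzero in this range, times the wanted value. *)
Let phi_lowE m n j : (n.+1 < p)%N -> phi (F ^+ m * E ^+ n * K ^+ j) = 0.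
Proof.
move=> np; have /esym/eqP := phi_s0 (F ^+ m * E ^+ n.+1 * K ^+ j) v`_1.
rewrite !actMv s0FX s0EXS; last by rewrite s0KX s0_pure xi_v scale0r mulr0 scaler0.
rewrite s1KX s1_pure !xi_v mul0r scale1r mulr1 -!scalerAr scalerA phiZ !mulrA.
rewrite mulf_eq0 => /orP[|/eqP //]; apply: contraTeq => _.
by rewrite !mulf_neq0 ?q_subV_neq0 ?invr_eq0 ?expf_neq0 ?q_neq0 ?q_sub_neq0.
Qed.

(** Same argument from v_0 to v_1 with one extra [F]; the extra [K] in the test element cancels the
    [K^-1] created by the coproduct of [F]. *)
Let phi_lowF m n j : (m.+1 < p)%N -> phi (F ^+ m * E ^+ n * K ^+ j) = 0.
Proof.
move=> mp; have /esym/eqP := phi_s1 (F ^+ m.+1 * E ^+ n * K ^+ j.+1) v`_0.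
have sum_neq0 : \sum_(i < m.+1) q ^+ (2 * i) != 0.
  have /negPf := @q2_expr_neq1 m.+1 mp; apply: contraFN => /eqP sum0.
  rewrite -subr_eq0 exprM subrX1.
  by under eq_bigr do rewrite -exprM; rewrite sum0 mulr0.
have z1 w : xi1 w = 0 ->
    s1 (act T (E ^+ n) (act T (K ^+ j.+1) (pure (1 : U) w))) = 0.
  by move=> w1; rewrite s1EX s1KX s1_pure w1 scale0r !mulr0 !scaler0 mulr0 scaler0.
rewrite !actMv s1FXS ?z1 ?xi_v // s0EX; last first.
  by rewrite s1KX s1_pure xi_v scale0r mulr0 scaler0.
rewrite s0KX s0_pure !xi_v mul0r scale1r mulr1 -!scalerAr scalerA !phiZ mulrA.
rewrite -!mulrA (mulrA K^-1) KV_EX -scalerAl [K ^+ _]exprS -(mulrA _ K^-1) mulKr ?K_unit //.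
rewrite -scalerAr phiZ !mulrA mulf_eq0 => /orP[|/eqP //]; apply: contraTeq => _.
by rewrite !mulf_neq0 ?invr_eq0 ?expf_neq0 ?q_neq0.
Qed.

(** Both sides of [phi_s0] at v_0 involve the same value, with relative factor q^(p+1) q^(p-1) q^j =
    q^j, which is not 1. *)
Let phi_top j : (0 < j < 2 * p)%N -> phi (F ^+ p.-1 * E ^+ p.-1 * K ^+ j) = 0.
Proof.
case/andP=> j_gt0 j_lt; apply/eqP; have := phi_s0 (F ^+ p.-1 * E ^+ p.-1 * K ^+ j) v`_0.
rewrite !actMv s0FX s0EX; last by rewrite s1KX s1_pure xi_v scale0r mulr0 scaler0.
rewrite s0KX s0_pure !xi_v mul1r scale1r mulr1 -!scalerAr !phiZ !mulrA -!exprD.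
have -> : (p + 1 + p.-1 = 2 * p)%N by rewrite addn1 addSnnS prednK ?p_gt0 // mul2n addnn.
rewrite exprD (prim_expr_order q_prim) mul1r -{1}[phi _]mul1r.
move/eqP; rewrite -subr_eq0 -mulrBl mulf_eq0 subr_eq0 eq_sym q_expr_eq1.
by case/orP=> // /dvdn_leq => /(_ j_gt0); rewrite leqNgt j_lt.
Qed.

Lemma modified_trace_monomial m n j : (m < p)%N -> (n < p)%N -> (j < 2 * p)%N ->
  trace_slf t (F ^+ m * E ^+ n * K ^+ j) =
    trace_slf t (F ^+ p.-1 * E ^+ p.-1) * (m == p.-1)%:R * (n == p.-1)%:R * (j == 0%N)%:R.
Proof.
rewrite -!/(phi _) => mp np j2p.
have [->|m_neq] := eqVneq m p.-1; last first.
  rewrite mulr0 !mul0r phi_lowF //; move: m_neq mp p_gt1; lia.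
have [->|n_neq] := eqVneq n p.-1; last first.
  rewrite mulr0 !mul0r phi_lowE //; move: n_neq np p_gt1; lia.
have [->|j_neq] := eqVneq j 0%N; first by rewrite !mulr1.
by rewrite mulr0 phi_top // lt0n j_neq.
Qed.

End TwoDimensionalSimple.

(** * X^+(p) as a direct summand of the regular module *)

Section SteinbergSummand.
Local Arguments regular : simpl never.
Variables (V : fdmod U) (v : p.-tuple V).
Hypothesis v_std : is_stdbasis_simple q E F K false v.

Let basis_v := sim_basis v_std.

(* e projects onto the K-eigenspace of the lowest weight vector v_(p-1), and w is
   the image of v_0 in the regular module. *)
Let x0 : U := q ^+ p.-1 *: K.
Let e : U := (2 * p)%:R^-1 *: \sum_(k < 2 * p) x0 ^+ k.
Let w : U := (qfact q p.-1 ^+ 2)^-1 *: (E ^+ p.-1 * e).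

Lemma qfact_neq0 n : (n < p)%N -> qfact q n != 0.
Proof.
move=> np; rewrite /qfact big_add1 big_mkord; apply/prodf_neq0 => i _.
by rewrite qint_neq0 // (leq_ltn_trans _ np).
Qed.

Let K_v k : (k < p)%N -> act V K v`_k = (q ^+ p.-1 * q ^- (2 * k)) *: v`_k.
Proof.
move=> kp; rewrite (sim_K v_std) // /sgnb mul1r; congr (_ *: _).
by rewrite -q_exprzB; congr (q ^ _); have := p_gt0; lia.
Qed.

Let FX_v0 k : (k < p)%N -> act V (F ^+ k) v`_0 = v`_k.
Proof.
elim: k => [|k IHk] kp; first by rewrite act1v.
by rewrite actXSv IHk ?(sim_F v_std) // ltnW.
Qed.

Let EX_last k : (k < p)%N -> act V (E ^+ k) v`_p.-1 =
  (\prod_(i < k) (qint q (p.-1 - i) * qint q i.+1)) *: v`_(p.-1 - k).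
Proof.
elim: k => [|k IHk] kp; first by rewrite act1v big_ord0 scale1r subn0.
rewrite actXSv IHk 1?ltnW // linearZ_LR /= (sim_E v_std); last by lia.
rewrite scalerA big_ord_recr /= /sgnb mul1r; congr (_ *: v`__); last by lia.
by congr (_ * (_ * qint q _)); lia.
Qed.

(** The factor picked up in raising v_(p-1) to v_0 by [E^(p-1)], which explains the normalization of
    [w]. *)
Let prod_qfact : \prod_(i < p.-1) (qint q (p.-1 - i) * qint q i.+1) = qfact q p.-1 ^+ 2.
Proof.
rewrite big_split /= expr2; congr (_ * _); last first.
  by rewrite /qfact big_add1 /= big_mkord.
rewrite (reindex_inj rev_ord_inj) /qfact big_add1 /= big_mkord.
by apply: eq_bigr => i _ /=; congr (qint q _); have := ltn_ord i; lia.
Qed.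

Let x0_e : x0 * e = e.
Proof.
have x02p : x0 ^+ (2 * p) = 1.
  by rewrite exprZn (uq_K2p Uq) -exprM mulnC exprM (prim_expr_order q_prim) expr1n scale1r.
apply/eqP; rewrite -subr_eq0 -{2}[e]mul1r -mulrBl /e -scalerAr -subrX1 x02p.
by rewrite subrr scaler0.
Qed.

Let e_last : act V e v`_p.-1 = v`_p.-1.
Proof.
have x0v : act V x0 v`_p.-1 = v`_p.-1.
  rewrite actZv K_v ?ltn_predL ?p_gt0 // scalerA mulrA -exprD.
  by rewrite addnn -mul2n mulfV ?expf_neq0 ?q_neq0 // scale1r.
have x0Xv k : act V (x0 ^+ k) v`_p.-1 = v`_p.-1.
  by elim: k => [|k IHk]; [rewrite act1v|rewrite actXSv IHk].
rewrite /e actZv linear_sum sum_lfunE; under eq_bigr do rewrite x0Xv.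
by rewrite sumr_const card_ord -scaler_nat scalerA mulVf ?two_p_neq0 // scale1r.
Qed.

Let K_e : K * e = q ^- p.-1 *: e.
Proof.
rewrite -[in RHS]x0_e -scalerAl scalerA mulVf ?scale1r //.
by rewrite expf_neq0 ?q_neq0.
Qed.

Let K_w : K * w = q ^+ p.-1 *: w.
Proof.
rewrite /w -scalerAr [RHS]scalerA mulrC -scalerA mulrA K_EX -scalerAl -mulrA K_e.
rewrite -scalerAr !scalerA -mulrA; congr (_ * _ *: _).
by rewrite mul2n -addnn exprD mulfK // expf_neq0 ?q_neq0.
Qed.

Let E_w : E * w = 0.
Proof.
by rewrite /w -scalerAr mulrA -exprS prednK ?p_gt0 // (uq_Ep Uq) mul0r scaler0.
Qed.

Let K_Fw k : K * (F ^+ k * w) = (q ^+ p.-1 * q ^- (2 * k)) *: (F ^+ k * w).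
Proof. by rewrite mulrA K_FX -scalerAl -mulrA K_w -scalerAr scalerA mulrC. Qed.

(** [w] is a highest weight vector of weight q^(p-1), so the usual commutator recursion gives the
    vectors [F^k w] the coefficients of X^+(p). *)
Let E_FSw k : (k < p)%N ->
  E * (F ^+ k.+1 * w) = (qint q k.+1 * qint q (p - k.+1)) *: (F ^+ k * w).
Proof.
have step x : E * (F * x) = F * (E * x) + (q - q^-1)^-1 *: (K * x - K^-1 * x).
  by rewrite !mulrA (uq_EF Uq) mulrDl -scalerAl mulrBl.
have KV_Fw i : K^-1 * (F ^+ i * w) = (q ^+ (2 * i) * q ^- p.-1) *: (F ^+ i * w).
  have := K_Fw i; move: (F ^+ i * w) => x Kx.
  apply: (mulrI K_unit); rewrite mulVKr ?K_unit // -scalerAr Kx scalerA.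
  by rewrite mulrA mulfVK ?mulfV ?scale1r // expf_neq0 ?q_neq0.
have stepF i : E * (F ^+ i.+1 * w) = F * (E * (F ^+ i * w)) +
    ((q - q^-1)^-1 * (q ^+ p.-1 * q ^- (2 * i) - q ^+ (2 * i) * q ^- p.-1))
      *: (F ^+ i * w).
  by rewrite [F ^+ i.+1]exprS -(mulrA F) step K_Fw KV_Fw -scalerBl scalerA.
elim: k => [|k IHk] kp; rewrite stepF.
  rewrite mul1r E_w mulr0 add0r; congr (_ *: _).
  rewrite /qint subn1 muln0 expr0; field.
  by rewrite oner_neq0 q_neq0 q2_sub1_neq0 expf_neq0 ?q_neq0.
rewrite IHk 1?ltnW // -(scalerAr _ F (F ^+ k * w)) (mulrA F) -exprS -scalerDl; congr (_ *: _).
(* Removes the truncated subtraction so that [field] sees independent powers of q. *)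
have [d ->] : exists d, p = (d + k.+2)%N by exists (p - k.+2)%N; rewrite subnK.
rewrite /qint addnK addnS -addSn addnK /= mul2n -addnn !exprD !exprS; field.
by rewrite q_neq0 q2_sub1_neq0 !expf_neq0 ?q_neq0.
Qed.

Let inc_fun (x : V) : U := \sum_(i < p) coord v i x *: (F ^+ i * w).

Let inc_fun_linear : linear inc_fun.
Proof.
move=> c x y; rewrite /inc_fun scaler_sumr -big_split; apply: eq_bigr => i _ /=.
by rewrite linearP scalerDl scalerA.
Qed.

HB.instance Definition _ := GRing.isSemilinear.Build C V U _ inc_fun
  (GRing.semilinear_linear inc_fun_linear).

Let inc : 'Hom(V, regular U) := linfun inc_fun.

Let inc_v k : (k < p)%N -> inc v`_k = F ^+ k * w.
Proof.
move=> kp; rewrite lfunE /= /inc_fun (bigD1 (Ordinal kp)) //= big1 ?addr0 => [|i].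
  by rewrite (coord_free (Ordinal kp) (Ordinal kp) (basis_free basis_v)) eqxx scale1r.
move=> /negPf ik; have := coord_free (Ordinal kp) i (basis_free basis_v) => /= ->.
by rewrite eq_sym ik scale0r.
Qed.

Let inc_hom : mod_hom inc.
Proof.
have bas (f g : {linear V -> regular U}) :
    (forall k, (k < p)%N -> f v`_k = g v`_k) -> f =1 g.
  move=> fg; apply: (span_linear_eq (X := v)); first exact: span_basis basis_v.
  by move=> x /(nthP 0)[k]; rewrite size_tuple => kp <-; apply: fg.
apply: uq_mod_hom.
- apply: (bas (inc \o act V E) (act (regular U) E \o inc)) => -[|k] kp /=.
    by rewrite (sim_E0 v_std) linear0 inc_v // act_regE mul1r E_w.
  rewrite (sim_E v_std) // linearZ_LR !inc_v ?act_regE ?E_FSw // 1?ltnW //=.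
  by rewrite inc_v /sgnb ?mul1r // ltnW.
- apply: (bas (inc \o act V F) (act (regular U) F \o inc)) => k kp /=.
  rewrite inc_v // act_regE mulrA -exprS.
  have [k1p|pk] := ltnP k.+1 p; first by rewrite (sim_F v_std) // inc_v.
  have -> : k = p.-1 by lia.
  by rewrite (sim_Flast v_std) linear0 prednK ?p_gt0 // (uq_Fp Uq) mul0r.
- apply: (bas (inc \o act V K) (act (regular U) K \o inc)) => k kp /=.
  by rewrite K_v // linearZ_LR /= !inc_v // lfunE /= K_Fw.
Qed.

(** The module map sending 1 to the lowest weight vector; it sends [w] to v_0 and therefore retracts
    [inc]. *)
Let ret_fun (x : U) : V := act V x v`_p.-1.

Let ret_fun_linear : linear ret_fun.
Proof. by move=> c x y; rewrite /ret_fun actDv actZv. Qed.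

HB.instance Definition _ := GRing.isSemilinear.Build C U V _ ret_fun
  (GRing.semilinear_linear ret_fun_linear).

Let ret : 'Hom(regular U, V) := linfun ret_fun.

Let ret_hom : mod_hom ret.
Proof. by move=> x y; rewrite !lfunE /= /ret_fun actMv. Qed.

Let ret_inc : (ret \o inc)%VF = \1%VF.
Proof.
apply/lfunP; apply: (span_linear_eq (X := v)); first exact: span_basis basis_v.
move=> x /(nthP 0)[k]; rewrite size_tuple => kp <-.
rewrite /= comp_lfunE id_lfunE inc_v // -act_regE ret_hom lfunE /= /ret_fun actZv.
rewrite actMv e_last EX_last ?ltn_predL ?p_gt0 // prod_qfact subnn scalerA.
by rewrite mulVf ?expf_neq0 ?qfact_neq0 ?ltn_predL ?p_gt0 // scale1r FX_v0.
Qed.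

(** By cyclicity the trace of the identity of [V] is that of [inc \o ret], which is right
    multiplication by [F^(p-1) w]. Expanding [e] in powers of [K], only the zeroth power
    survives. *)
Lemma trace_steinberg (t : forall M : fdmod U, 'End(M) -> C) :
  is_trace t ->
  (forall j, (0 < j < 2 * p)%N ->
     trace_slf t (F ^+ p.-1 * E ^+ p.-1 * K ^+ j) = 0) ->
  trace_slf t (F ^+ p.-1 * E ^+ p.-1) =
    (2 * p)%:R * qfact q p.-1 ^+ 2 * t V \1%VF.
Proof.
move=> tr_t t0; have [_ tC] := tr_t.
have regP := @regular_projective C U.
have VP : projective V := retract_projective inc_hom ret_hom ret_inc regP.
have inc_ret_hom : mod_hom (inc \o ret)%VF by apply: mod_hom_comp.
have phi_w : trace_slf t (F ^+ p.-1 * w : U) = ((2 * p)%:R * qfact q p.-1 ^+ 2)^-1 *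
    trace_slf t (F ^+ p.-1 * E ^+ p.-1).
  rewrite /w -scalerAr (trace_slfZ tr_t) mulrA /e -scalerAr (trace_slfZ tr_t).
  rewrite mulr_sumr (trace_slf_sum tr_t) (bigD1 (Ordinal (prim_order_gt0 q_prim))) //=.
  rewrite big1 => [|k k_neq0]; last first.
    rewrite exprZn -scalerAr (trace_slfZ tr_t) t0 ?mulr0 // ltn_ord andbT lt0n.
    by apply: contra k_neq0 => /eqP k0; apply/eqP/val_inj.
  by rewrite addr0 expr0 mulr1 mulrA; congr (_ * _); rewrite [RHS]invfM mulrC.
have t_V : t V \1%VF = trace_slf t (F ^+ p.-1 * w : U).
  rewrite -ret_inc (tC _ _ VP regP) // (mod_hom_regular inc_ret_hom).
  rewrite comp_lfunE [ret 1]lfunE /= /ret_fun act1v inc_v //.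
  by rewrite ltn_predL p_gt0.
rewrite t_V phi_w mulrA mulfV ?mul1r //.
by rewrite mulf_neq0 ?expf_neq0 ?two_p_neq0 ?qfact_neq0 ?ltn_predL ?p_gt0.
Qed.

End SteinbergSummand.

(** * Characters on powers of the Casimir element *)

Section Casimir.

(** The usual quantum Casimir element scaled by (q - q^-1)^2, so that its eigenvalue on X^alpha(s)
    is alpha (q^s + q^-s). *)
Definition casimir : U :=
  (q - q^-1) ^+ 2 *: (F * E) + q *: K + q^-1 *: K^-1.

Lemma KV_F : K^-1 * F = q ^+ 2 *: (F * K^-1).
Proof.
apply: (mulrI K_unit); rewrite mulVKr ?K_unit // -scalerAr mulrA (uq_KF Uq).
by rewrite -scalerAl scalerA mulfV ?expf_neq0 ?q_neq0 // scale1r mulrK ?K_unit.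
Qed.

Lemma casimir_F : GRing.comm casimir F.
Proof.
have FEF : F * E * F = F * (F * E) + (q - q^-1)^-1 *: (F * K - F * K^-1).
  by rewrite -mulrA (uq_EF Uq) mulrDr -scalerAr mulrBr.
rewrite /GRing.comm /casimir !mulrDl !mulrDr -!scalerAl -!scalerAr FEF.
rewrite (uq_KF Uq) KV_F !scalerDr !scalerA scalerN -!addrA; congr (_ + _).
have -> : (q - q^-1) ^+ 2 * (q - q^-1)^-1 = q - q^-1.
  by rewrite expr2 mulfK ?q_sub_neq0.
have -> : q * q ^- 2 = q^-1 by rewrite expr2 invfM mulVKf ?q_neq0.
have -> : q^-1 * q ^+ 2 = q by rewrite expr2 mulKf ?q_neq0.
by rewrite addrA !scalerBl addrACA subrK opprB subrK.
Qed.

Lemma casimir_FX m : GRing.comm casimir (F ^+ m).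
Proof. exact: commrX casimir_F. Qed.

(** The innermost [F E] is the Casimir element minus its [K] parts. The former is pulled out past
    [F^m], the latter are pushed right past [E^m]; the exponent [(2 * p).-1] encodes [K^-1]. *)
Lemma casimir_step l m j :
  (q - q^-1) ^+ 2 *: (casimir ^+ l * (F ^+ m.+1 * E ^+ m.+1 * K ^+ j)) =
  casimir ^+ l.+1 * (F ^+ m * E ^+ m * K ^+ j)
  - q ^+ (2 * m).+1 *: (casimir ^+ l * (F ^+ m * E ^+ m * K ^+ j.+1))
  - q ^- (2 * m).+1 *: (casimir ^+ l * (F ^+ m * E ^+ m * K ^+ (j + (2 * p).-1))).
Proof.
have FEc : (q - q^-1) ^+ 2 *: (F * E) = casimir - q *: K - q^-1 *: K^-1.
  by rewrite /casimir addrAC !addrK.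
have -> : (q - q^-1) ^+ 2 *: (casimir ^+ l * (F ^+ m.+1 * E ^+ m.+1 * K ^+ j)) =
    casimir ^+ l * (F ^+ m * ((q - q^-1) ^+ 2 *: (F * E)) * E ^+ m * K ^+ j).
  by rewrite [F ^+ _]exprSr [E ^+ _]exprS -(scalerAr _ (F ^+ m)) -!scalerAl -scalerAr !mulrA.
rewrite FEc !mulrBr !mulrBl !mulrBr; congr (_ - _ - _).
- by rewrite -(casimir_FX m) [casimir ^+ l.+1]exprSr !mulrA.
- rewrite -scalerAr -!scalerAl -scalerAr -(mulrA _ K) K_EX -scalerAr -scalerAl.
  by rewrite -scalerAr scalerA -exprS [K ^+ j.+1]exprS !mulrA.
- rewrite -scalerAr -!scalerAl -scalerAr -(mulrA _ K^-1) KV_EX -scalerAr -scalerAl.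
  by rewrite -scalerAr scalerA -invfM -exprS K_inv addnC exprD !mulrA.
Qed.

(** Under [casimir_step] the sum [m + l] is kept in the first term and drops by one in the others,
    while [m] decreases; hence the induction on [m] with [l] free. *)
Lemma casimir_reduction (f : {scalar U}) m l j :
  (forall l j, (l < p.-1)%N -> f (casimir ^+ l * K ^+ j) = 0) ->
  (m + l < p.-1)%N -> f (casimir ^+ l * (F ^+ m * E ^+ m * K ^+ j)) = 0.
Proof.
move=> f0; elim: m l j => [|m IHm] l j lm; first by rewrite !mul1r f0.
have q2 : (q - q^-1) ^+ 2 != 0 by rewrite expf_neq0 ?q_sub_neq0.
apply: (mulfI q2); rewrite mulr0 -linearZ_LR casimir_step !linearB !linearZ_LR /=.
by rewrite !IHm ?mulr0 ?subr0 // ?addnS // ltnW.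
Qed.

Lemma casimir_reduction_top (f : {scalar U}) m l j :
  (forall l j, (l < p.-1)%N -> f (casimir ^+ l * K ^+ j) = 0) ->
  (m + l)%N = p.-1 ->
  (q - q^-1) ^+ (2 * m) * f (casimir ^+ l * (F ^+ m * E ^+ m * K ^+ j)) =
    f (casimir ^+ p.-1 * K ^+ j).
Proof.
move=> f0; elim: m l j => [|m IHm] l j lm.
  by rewrite expr0 !mul1r -lm.
rewrite mulnS addnC exprD -mulrA -linearZ_LR casimir_step !linearB !linearZ_LR /=.
have low j' := @casimir_reduction f m l j' f0.
rewrite !low ?mulr0 ?subr0; try by rewrite -lm.
by rewrite IHm // addnS.
Qed.

End Casimir.

Definition weight (alpha : bool) (s i : nat) : C :=
  sgnb C alpha * q ^ (s%:Z - 1 - 2 * i%:Z).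

Lemma weightE alpha s i : weight alpha s i = sgnb C alpha * (q ^+ s * q ^- (2 * i).+1).
Proof. by rewrite /weight -q_exprzB; congr (_ * q ^ _); lia. Qed.

Lemma sgnb_neq0 alpha : sgnb C alpha != 0.
Proof. by rewrite expf_neq0 ?oppr_eq0 ?oner_neq0. Qed.

Lemma weight_neq0 alpha s i : weight alpha s i != 0.
Proof. by rewrite weightE !mulf_neq0 ?sgnb_neq0 ?invr_eq0 ?expf_neq0 ?q_neq0. Qed.

Definition casimir_value (alpha : bool) (s : nat) : C :=
  sgnb C alpha * (q ^+ s + q ^- s).

Lemma casimir_valueE alpha s i : (i < s)%N ->
  (q - q^-1) ^+ 2 * (sgnb C alpha * qint q i * qint q (s - i)) +
    q * weight alpha s i + q^-1 * (weight alpha s i)^-1 = casimir_value alpha s.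
Proof.
move=> /subnK <-; rewrite weightE /casimir_value /sgnb /qint.
move: (s - i.+1)%N => d; rewrite addnS -addSn addnK.
rewrite mul2n -addnn !(exprD, exprS).
by case: alpha; rewrite /= ?expr1 ?expr0; field;
  rewrite !expf_neq0 ?q_neq0 ?q2_sub1_neq0 ?oppr_eq0 ?oner_neq0.
Qed.

Lemma KV_weight (M : fdmod U) u k : k != 0 -> act M K u = k *: u ->
  act M K^-1 u = k^-1 *: u.
Proof.
move=> k0 Ku; rewrite -[RHS](act1v) -(mulVr K_unit) actMv linearZ_LR /= Ku.
by rewrite scalerA mulVf // scale1r.
Qed.

Lemma KX_weight (M : fdmod U) u k j : act M K u = k *: u ->
  act M (K ^+ j) u = k ^+ j *: u.
Proof.
move=> Ku; elim: j => [|j IHj]; first by rewrite act1v scale1r.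
by rewrite actXSv IHj linearZ_LR /= Ku scalerA -exprSr.
Qed.

(** The term [u'] carries the nilpotent part: it is 0 on simple modules and on the a_i, and it is
    a_i for the vector b_i. *)
Lemma casimir_act (M : fdmod U) alpha s i u u' : (i < s)%N ->
  act M K u = weight alpha s i *: u ->
  act M (F * E) u = (sgnb C alpha * qint q i * qint q (s - i)) *: u + u' ->
  act M casimir u = casimir_value alpha s *: u + (q - q^-1) ^+ 2 *: u'.
Proof.
move=> lt_is Ku FEu; rewrite /casimir !actDv !actZv FEu Ku.
rewrite (KV_weight (weight_neq0 alpha s i)) // scalerDr !scalerA.
rewrite -(casimir_valueE alpha lt_is) !scalerDl -!addrA; congr (_ + _).
by rewrite addrC addrA.
Qed.

Section SimpleTrace.
Variables (alpha : bool) (s : nat) (X : fdmod U).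
Hypothesis X_std : is_simple_X q E F K alpha s X.

Lemma mchar_simple l j : mchar X (casimir ^+ l * K ^+ j) =
  casimir_value alpha s ^+ l * \sum_(i < s) weight alpha s i ^+ j.
Proof.
have [v v_std] := X_std; have bv := sim_basis v_std.
rewrite (mchar_basisE _ bv) mulr_sumr; apply: eq_bigr => i _.
have Kv := sim_K v_std (ltn_ord i).
have FEv : act X (F * E) v`_i =
    (sgnb C alpha * qint q i * qint q (s - i)) *: v`_i + 0.
  rewrite addr0 actMv; case: i {Kv} => -[|i] /= lt_is.
    by rewrite (sim_E0 v_std) linear0 qint0 mulr0 mul0r scale0r.
  by rewrite (sim_E v_std) // linearZ_LR /= (sim_F v_std).
have := casimir_act (ltn_ord i) Kv FEv; rewrite scaler0 addr0 => cas_v.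
have cas_vX : act X (casimir ^+ l) v`_i = casimir_value alpha s ^+ l *: v`_i.
  elim: (l) => [|l' IHl]; first by rewrite act1v scale1r.
  by rewrite actXSv IHl linearZ_LR /= cas_v scalerA -exprSr.
rewrite actMv (KX_weight _ Kv) linearZ_LR /= cas_vX !linearZ_LR /=.
by rewrite coord_free ?(basis_free bv) // eqxx mulr1 mulrC.
Qed.

Lemma mchar_simple_weight c x : K * x = c *: (x * K) -> c != 1 -> mchar X x = 0.
Proof.
move=> Kx c1; have [v v_std] := X_std; have bv := sim_basis v_std.
have Kv i (lt_is : (i < s)%N) := sim_K v_std lt_is.
rewrite (mchar_basisE _ bv) big1 // => i _.
apply: (weight_coord0 bv _ (Kv i _) (Kv i _) (weight_neq0 alpha s i) Kx c1) => //.
move=> u /(nthP 0)[k]; rewrite size_tuple => /Kv Kk <-.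
by exists (weight alpha s k).
Qed.

End SimpleTrace.

Section ProjectiveTrace.
Variables (alpha : bool) (s : nat) (P : based_mod U p s).
Hypothesis P_std : is_proj_P q E F K alpha P.

Let idx_a (l : 'I_s) := rshift s (rshift (p - s) (rshift (p - s) l)).

Let nth_b (i : 'I_s) : (stdbasis P)`_(lshift (p - s + (p - s + s)) i) = (vb P)`_i.
Proof. by rewrite /= nth_cat size_tuple ltn_ord. Qed.

Let nth_a (l : 'I_s) : (stdbasis P)`_(idx_a l) = (va P)`_l.
Proof.
by rewrite /=; do 3!rewrite nth_cat size_tuple ltnNge leq_addr /= addKn.
Qed.

Let bP := prj_basis P_std.

Let coord_a (l : 'I_s) : coord (stdbasis P) (idx_a l) (va P)`_l = 1.
Proof. by rewrite -nth_a coord_free ?(basis_free bP) // eqxx. Qed.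

Let coord_b (i l : 'I_s) : coord (stdbasis P) (idx_a l) (vb P)`_i = 0.
Proof.
by rewrite -nth_b coord_free ?(basis_free bP) // -val_eqE /= ltn_eqF // ltn_addr.
Qed.

(** On the span of b_i and a_i the Casimir element is a Jordan block with off-diagonal entry (q -
    q^-1)^2, whose l-th power has the derivative of c^l as a factor off the diagonal. *)
Lemma tr_Hmat_casimir l j : \tr (Hmat P (casimir ^+ l * K ^+ j)) =
  l%:R * casimir_value alpha s ^+ l.-1 * (q - q^-1) ^+ 2 *
    \sum_(i < s) weight alpha s i ^+ j.
Proof.
rewrite mulr_sumr; apply: eq_bigr => i _; rewrite mxE.
have lt_is := ltn_ord i.
have Kb := prj_Kb P_std lt_is; have Ka := prj_Ka P_std lt_is.
have FEb : act P (F * E) (vb P)`_i =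
    (sgnb C alpha * qint q i * qint q (s - i)) *: (vb P)`_i + (va P)`_i.
  rewrite actMv; case: i {Kb Ka} lt_is => -[|i] /= _ lt_is.
    (* At i = 0 the vector a_0 is reached through x_(p-s-1), and the diagonal coefficient is 0
       because [0] = 0. *)
    rewrite (prj_Eb0 P_std) (prj_Fxlast P_std).
    by rewrite qint0 mulr0 mul0r scale0r add0r.
  rewrite (prj_Eb P_std) // linearD linearZ_LR /= (prj_Fb P_std) //.
  by rewrite (prj_Fa P_std).
have FEa : act P (F * E) (va P)`_i =
    (sgnb C alpha * qint q i * qint q (s - i)) *: (va P)`_i + 0.
  rewrite addr0 actMv; case: i {Kb Ka FEb} lt_is => -[|i] /= _ lt_is.
    by rewrite (prj_Ea0 P_std) linear0 qint0 mulr0 mul0r scale0r.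
  by rewrite (prj_Ea P_std) // linearZ_LR /= (prj_Fa P_std).
have cas_b := casimir_act lt_is Kb FEb.
have := casimir_act lt_is Ka FEa; rewrite scaler0 addr0 => cas_a.
pose c := casimir_value alpha s.
have cas_bX : act P (casimir ^+ l) (vb P)`_i = c ^+ l *: (vb P)`_i +
    (l%:R * c ^+ l.-1 * (q - q^-1) ^+ 2) *: (va P)`_i.
  elim: (l) => [|l' IHl]; first by rewrite act1v scale1r !mul0r scale0r addr0.
  rewrite actXSv IHl linearD !linearZ_LR /= cas_a cas_b -/c scalerDr !scalerA.
  rewrite -exprSr -addrA -scalerDl; congr (_ + _ *: _).
  by case: l' {IHl} => [|l'] /=; rewrite ?exprS -?natr1; ring.
rewrite actMv (KX_weight _ Kb) linearZ_LR /= cas_bX linearZ_LR linearD !linearZ_LR /=.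
by rewrite coord_a coord_b; ring.
Qed.

Lemma tr_Hmat_weight c x : K * x = c *: (x * K) -> c != 1 -> \tr (Hmat P x) = 0.
Proof.
move=> Kx c1; apply: big1 => i _; rewrite mxE.
have Kb := prj_Kb P_std (ltn_ord i); have Ka := prj_Ka P_std (ltn_ord i).
rewrite -nth_a in Ka.
apply: (weight_coord0 bP _ Ka Kb (weight_neq0 alpha s i) Kx c1) => u.
rewrite !mem_cat => /or4P[] /(nthP 0)[k]; rewrite size_tuple => lt_k <-.
- by eexists; apply: (prj_Kb P_std).
- by eexists; apply: (prj_Kx P_std).
- by eexists; apply: (prj_Ky P_std).
- by eexists; apply: (prj_Ka P_std).
Qed.

End ProjectiveTrace.

(** * Fourier sums over the 2p-th roots of unity *)

Section Fourier.

Definition bracket (l : nat) (x : C) : C :=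
  (x + x^-1) ^+ l.+1 + l%:R * (x - x^-1) ^+ 2 * (x + x^-1) ^+ l.-1.

(* hpoly l is x^(l+1) times the Laurent polynomial (x - 1/x) (x + 1/x)^l, of
   which bracket l is the image under x d/dx. *)
Definition hpoly (l : nat) : {poly C} := ('X^2 - 1%:P) * ('X^2 - (-1)%:P) ^+ l.
(** The operator x d/dx conjugated by x^(l+1), applied to [hpoly l]. *)
Definition bracket_poly (l : nat) : {poly C} :=
  'X * (hpoly l)^`() - l.+1%:R *: hpoly l.

Lemma bracketE l x : x != 0 -> bracket l x = x ^- l.+1 * (bracket_poly l).[x].
Proof.
move=> x0; rewrite /bracket /bracket_poly /hpoly derivM deriv_exp !derivB !derivXn.
rewrite !derivC !subr0 /= !(hornerE, hornerMn, horner_exp) /=.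
have -> : x + x^-1 = (x ^+ 2 - -1) / x by field.
have -> : x - x^-1 = (x ^+ 2 - 1) / x by field.
rewrite -mulr_natl; case: l => [|l] /=; first by rewrite !mul0r; field.
rewrite !expr_div_n !exprS -natr1; move: (x ^+ l) (expf_neq0 l x0) => y y0.
by move: ((_ - -1) ^+ l) => z; field; rewrite x0 y0.
Qed.

Lemma bracket_poly_coef l k :
  (bracket_poly l)`_k = (k%:R - l.+1%:R) * (hpoly l)`_k.
Proof.
rewrite /bracket_poly coefB coefXM coefZ mulrBl; congr (_ - _).
by case: k => [|k] /=; rewrite ?mul0r // coef_deriv mulr_natl.
Qed.

Lemma hpoly_monic l : hpoly l \is monic.
Proof. by rewrite monicMl ?monic_exp ?monicXnsubC. Qed.

Lemma hpoly_size l : size (hpoly l) = (2 * l).+3.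
Proof.
rewrite size_monicM ?monicXnsubC ?monic_neq0 ?monic_exp ?monicXnsubC //.
rewrite size_XnsubC // -[size (('X^2 - (-1)%:P : {poly C}) ^+ l)]prednK; first by rewrite size_exp size_XnsubC.
by rewrite lt0n size_poly_eq0 monic_neq0 ?monic_exp ?monicXnsubC.
Qed.

Lemma hpoly_coef0 l : (hpoly l)`_0 = -1.
Proof.
by rewrite -horner_coef0 /hpoly !(hornerE, horner_exp) /= expr0n /= !add0r opprK expr1n mulr1.
Qed.

Lemma hpoly_lead l : (hpoly l)`_(2 * l).+2 = 1.
Proof. by have /monicP := hpoly_monic l; rewrite /lead_coef hpoly_size. Qed.

Lemma geometric_root_sum (z : C) : z ^+ (2 * p) = 1 ->
  \sum_(s < 2 * p) z ^+ s = (2 * p)%:R *+ (z == 1).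
Proof.
move=> zp; have [->|z1] := eqVneq z 1.
  by under eq_bigr do rewrite expr1n; rewrite sumr_const card_ord.
have /eqP := subrX1 z (2 * p); rewrite zp subrr eq_sym mulf_eq0 subr_eq0.
by rewrite (negPf z1) => /eqP.
Qed.

(** The sign is q^(p e s), so the k-th monomial contributes a geometric sum with ratio q^(p e + k -
    l - 1), which vanishes unless this ratio is 1. *)
Lemma bracket_sumE (e : bool) l :
  \sum_(s < 2 * p) (-1) ^+ (e * s) * bracket l (q ^+ s) =
  \sum_(k < (2 * l).+3) (k%:R - l.+1%:R) * (hpoly l)`_k *
    ((2 * p)%:R *+ (p * e + k == l.+1 %[mod 2 * p])%N).
Proof.
have q0 := q_neq0.
have sz : (size (bracket_poly l) <= (2 * l).+3)%N.
  apply/leq_sizeP => k; rewrite -hpoly_size => hk.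
  by rewrite bracket_poly_coef nth_default ?mulr0.
under eq_bigr => s _.
  rewrite bracketE ?expf_neq0 // (horner_coef_wide _ sz) mulrA mulr_sumr.
  over.
rewrite exchange_big; apply: eq_bigr => k _ /=.
rewrite -(eq_prim_root_expr q_prim).
pose z := q ^+ (p * e + k) / q ^+ l.+1.
have -> : (q ^+ (p * e + k) == q ^+ l.+1) = (z == 1).
  apply/eqP/eqP => [zz|zz]; first by rewrite /z zz mulfV ?expf_neq0.
  by rewrite -[RHS]mul1r -zz mulfVK ?expf_neq0.
rewrite -geometric_root_sum; last first.
  by rewrite /z expr_div_n !(exprAC _ _ (2 * p)) (prim_expr_order q_prim) !expr1n divr1.
rewrite mulr_sumr; apply: eq_bigr => s _.
rewrite bracket_poly_coef /z expr_div_n exprD (exprM q p e) q_expr_p.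
rewrite exprMn -!exprM (mulnC k s) (mulnC l.+1 s).
by rewrite mulrA mulrAC mulrC !mulrA; ring.
Qed.

(** The exponents k - (l+1) lie between -(l+1) and l+1. Without sign only the exponent 0 survives,
    and x d/dx kills it; with sign the exponents p and -p would be needed, out of reach for l <
    p-1. *)
Lemma bracket_sum0 (e : bool) l : (l < p)%N -> ~~ (e && (l == p.-1)) ->
  \sum_(s < 2 * p) (-1) ^+ (e * s) * bracket l (q ^+ s) = 0.
Proof.
move=> lp el; rewrite bracket_sumE big1 // => k _; case: eqP => [/eqP km|]; last by rewrite mulr0.
suff -> : k = l.+1 :> nat by rewrite subrr !mul0r.
have k_lt := ltn_ord k; case: e el km => /= el; rewrite ?muln1 ?muln0 ?add0n.
  rewrite (modn_small (_ : l.+1 < 2 * p)%N); last by lia.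
  have [kp|pk] := ltnP k p; first by rewrite modn_small; lia.
  have -> : (p + k = (k - p) + 2 * p)%N by lia.
  by rewrite modnDr modn_small; lia.
rewrite (modn_small (_ : l.+1 < 2 * p)%N); last by lia.
have [kp|pk] := ltnP k (2 * p); first by rewrite modn_small // => /eqP.
have -> : k = (2 * p)%N :> nat by lia.
by rewrite modnn.
Qed.

(** The two extreme terms k = 0 and k = 2p survive, with coefficients (-p)(-1) and p, each
    multiplied by 2p. *)
Lemma bracket_sum_top :
  \sum_(s < 2 * p) (-1) ^+ s * bracket p.-1 (q ^+ s) = (2 * p)%:R ^+ 2.
Proof.
have := bracket_sumE true p.-1; under eq_bigr do rewrite mul1n; move=> ->.
rewrite big_ord_recl big_ord_recr /= prednK ?p_gt0 // hpoly_coef0 hpoly_lead.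
rewrite big1 => [|k _]; last first.
  rewrite [_ == _](negbTE _) ?mulr0 // muln1 [(p %% _)%N]modn_small; last by have := p_gt0; lia.
  have k_lt := ltn_ord k; rewrite /bump /=.
  have [kp|pk] := ltnP k.+1 p; first by rewrite modn_small; lia.
  have -> : (p + (1 + k) = (k.+1 - p) + 2 * p)%N by lia.
  by rewrite modnDr modn_small; lia.
have -> : (p * 1 + 0 == p %[mod 2 * p])%N by rewrite muln1 addn0.
have -> : (p * 1 + bump 0 (2 * p.-1).+1 == p %[mod 2 * p])%N.
  have -> : (p * 1 + bump 0 (2 * p.-1).+1 = p + 2 * p)%N.
    by rewrite /bump /=; have := p_gt0; lia.
  by rewrite modnDr.
have -> : (bump 0 (2 * p.-1).+1 = 2 * p)%N by rewrite /bump /=; have := p_gt0; lia.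
by rewrite mul2n -addnn !natrD !mulr1n; ring.
Qed.

End Fourier.

(** Divide the factorization of X^(n+1) - 1 by X - 1 and evaluate at 1. *)
Lemma primitive_root_prod (n : nat) (z : C) : n.+1.-primitive_root z ->
  \prod_(i < n) (1 - z ^+ i.+1) = n.+1%:R.
Proof.
move=> zP; have := factor_Xn_sub_1 zP.
rewrite big_nat_recl // expr0 subrX1 -[X in 'X - X]/(1%:P) => /mulfI.
rewrite polyXsubC_eq0 => /(_ isT) /(congr1 (horner^~ 1)).
rewrite big_mkord horner_prod horner_sum => E1.
transitivity (\prod_(i < n) ('X - (z ^+ i.+1)%:P).[1]).
  by apply: eq_bigr => i _; rewrite hornerXsubC.
rewrite E1; under eq_bigr do rewrite hornerXn expr1n.
by rewrite sumr_const card_ord.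
Qed.

(** Factorwise -(q^i - q^-i)^2 = (1 - q^(2i))(1 - q^(-2i)), and each of the two products over 0 < i
    < p equals p. *)
Lemma qfact_sqr :
  (q - q^-1) ^+ (2 * p.-1) * ((-1) ^+ p.-1 * qfact q p.-1 ^+ 2) = p%:R ^+ 2.
Proof.
have q2P : p.-1.+1.-primitive_root (q ^+ 2).
  rewrite prednK ?p_gt0 //; have := dvdn_prim_root q_prim (dvdn_mull 2 (dvdnn p)).
  by rewrite mulnK ?p_gt0.
have prodq := primitive_root_prod q2P; rewrite prednK ?p_gt0 // in prodq.
have prodqV : \prod_(i < p.-1) (1 - (q ^+ 2) ^- i.+1) = p%:R.
  rewrite (reindex_inj rev_ord_inj) -prodq; apply: eq_bigr => i _ /=.
  congr (1 - _); apply: (mulfI (_ : (q ^+ 2) ^+ (p.-1 - i.+1).+1 != 0)).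
    by rewrite !expf_neq0 ?q_neq0.
  rewrite mulfV ?expf_neq0 ?q_neq0 // -exprD -exprM.
  have -> : (2 * ((p.-1 - i.+1).+1 + i.+1) = 2 * p)%N by have := ltn_ord i; lia.
  by rewrite (prim_expr_order q_prim).
rewrite [in RHS]expr2 -[X in _ = X * _]prodq -[X in _ = _ * X]prodqV -big_split /= /qfact big_add1 big_mkord.
transitivity (\prod_(i < p.-1) ((q - q^-1) ^+ 2 * (-1 * qint q i.+1 ^+ 2))).
  rewrite [RHS]big_split /= [X in _ = _ * X]big_split /= !prodr_const !card_ord exprM.
  by rewrite prodrXl.
apply: eq_bigr => i _; rewrite /qint (exprAC q 2); move: (q ^+ i.+1) (expf_neq0 i.+1 q_neq0).
by move=> a a0; field; rewrite a0 q_neq0 q2_sub1_neq0.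
Qed.

Lemma sum_symmetric (G : nat -> C) :
  (forall s, (0 < s < p)%N -> G (2 * p - s)%N = G s) ->
  \sum_(s < 2 * p) G s = G 0%N + G p + (\sum_(1 <= s < p) G s) *+ 2.
Proof.
move=> Gsym; have p0 := p_gt0.
rewrite -(big_mkord xpredT) (big_cat_nat (n := p)) ?leq_pmull //=.
rewrite big_ltn // [X in _ + X]big_ltn; last by lia.
rewrite -[p.+1]add1n big_addn (_ : 2 * p - p = p)%N; last by lia.
rewrite [X in G p + X]big_nat_rev [X in G p + X](_ : _ = \sum_(1 <= s < p) G s).
  by rewrite mulr2n addrACA -!addrA; congr (_ + _); rewrite addrCA.
rewrite !big_nat; apply: eq_bigr => s /andP[s_gt0 sp].
by rewrite -[RHS]Gsym ?s_gt0 //; congr G; lia.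
Qed.

(* The weights of X^+(s) and X^-(p-s) together are the p weights q^(s-1-2i), i < p. *)
Definition weight_sum (s j : nat) : C := \sum_(i < p) weight false s i ^+ j.

Lemma weight_true s i : (s <= p)%N ->
  weight true (p - s) i = weight false s (s + i).
Proof.
move=> sp; rewrite !weightE /sgnb.
rewrite q_exprpB // expr1 expr0 (_ : (2 * (s + i)).+1 = s + s + (2 * i).+1)%N ?exprD; last by lia.
by field; rewrite !expf_neq0 ?q_neq0.
Qed.

Lemma weight_sumE s j : (s <= p)%N ->
  \sum_(i < s) weight false s i ^+ j + \sum_(i < p - s) weight true (p - s) i ^+ j
    = weight_sum s j.
Proof.
move=> sp; rewrite /weight_sum -(big_mkord xpredT (fun i => weight false s i ^+ j)).
rewrite -[\sum_(i < p) _](big_mkord xpredT (fun i => weight false s i ^+ j)).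
rewrite [RHS](big_cat_nat (n := s)) //=; congr (_ + _).
have := big_addn 0 p s xpredT (fun i => weight false s i ^+ j).
rewrite add0n => ->; rewrite big_mkord; apply: eq_bigr => i _.
by rewrite weight_true // addnC.
Qed.

(** Up to a scalar this is a geometric sum over the powers of q^(-2j), a p-th root of unity
    different from 1. *)
Lemma weight_sum0 s j : ~~ (p %| j)%N -> weight_sum s j = 0.
Proof.
move=> pj; pose z := q ^- (2 * j).
have -> : weight_sum s j = (q ^+ s / q) ^+ j * \sum_(i < p) z ^+ i.
  rewrite mulr_sumr; apply: eq_bigr => i _; rewrite weightE /sgnb mul1r /z.
  rewrite exprS invfM mulrA exprMn; congr (_ * _).
  by rewrite !exprVn -!exprM; congr (q ^- _); lia.
have z1 : z != 1.
  rewrite /z invr_eq1 q_expr_eq1 dvdn_pmul2l //.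
have := subrX1 z p; rewrite {1}/z exprVn -exprM -mulnA (mulnC j) mulnA exprM.
rewrite (prim_expr_order q_prim) expr1n invr1 subrr => /esym/eqP.
by rewrite mulf_eq0 subr_eq0 (negPf z1) /= => /eqP ->; rewrite mulr0.
Qed.

(** Raising to the power p r turns q^(s-1-2i) into a sign in which i no longer occurs. *)
Lemma weight_sum_mul s r : weight_sum s (p * r) = p%:R * (-1) ^+ r * (-1) ^+ (s * r).
Proof.
transitivity (\sum_(i < p) (-1 : C) ^+ r * (-1) ^+ (s * r)).
  apply: eq_bigr => i _; rewrite weightE /sgnb mul1r exprMn exprVn -!exprM.
  rewrite !(mulnCA _ p) (exprM q p) (exprM q p) q_expr_p.
  rewrite mulrC; congr (_ * _); apply: (mulfI (_ : (-1) ^+ ((2 * i).+1 * r) != 0)).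
    by rewrite expf_neq0 // oppr_eq0 oner_neq0.
  rewrite mulfV ?expf_neq0 ?oppr_eq0 ?oner_neq0 // -exprD -signr_odd.
  by rewrite oddD oddM /= oddM /= addbb.
by rewrite sumr_const card_ord -mulrA mulr_natl.
Qed.

(** * The combination of characters on the monomials *)

Section CharacterFormula.
Variables (X : bool -> nat -> fdmod U) (P : bool -> forall s, based_mod U p s).
Hypothesis X_std : forall alpha s, (1 <= s <= p)%N ->
  is_simple_X q E F K alpha s (X alpha s).
Hypothesis P_std : forall alpha s, (1 <= s <= p - 1)%N ->
  is_proj_P q E F K alpha (P alpha s).

Definition character_form (a : U) : C :=
  (-1) ^+ (p - 1) * mchar (X false p) a + mchar (X true p) a
  + \sum_(1 <= s < p)
      ((-1) ^+ s * (q ^+ s + q ^- s) * mchar (X false s) a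
       + (-1) ^+ (p - s - 1) * (q ^+ s + q ^- s) * mchar (X true s) a
       + (-1) ^+ s * qint q s ^+ 2 * Gform P s a).

Lemma character_form_is_scalar : scalar character_form.
Proof.
move=> c x y; rewrite /character_form !mcharP.
under eq_bigr do rewrite !mcharP GformP.
set S := \sum_(_ <= _ < _) _.
have -> : S = c * \sum_(1 <= s < p)
      ((-1) ^+ s * (q ^+ s + q ^- s) * mchar (X false s) x
       + (-1) ^+ (p - s - 1) * (q ^+ s + q ^- s) * mchar (X true s) x
       + (-1) ^+ s * qint q s ^+ 2 * Gform P s x) + \sum_(1 <= s < p)
      ((-1) ^+ s * (q ^+ s + q ^- s) * mchar (X false s) y
       + (-1) ^+ (p - s - 1) * (q ^+ s + q ^- s) * mchar (X true s) y
       + (-1) ^+ s * qint q s ^+ 2 * Gform P s y).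
  by rewrite mulr_sumr -big_split; apply: eq_bigr => s _ /=; ring.
ring.
Qed.

HB.instance Definition _ := GRing.isSemilinear.Build C U C _ character_form
  (GRing.semilinear_linear character_form_is_scalar).

Lemma character_form_weight c x : K * x = c *: (x * K) -> c != 1 -> character_form x = 0.
Proof.
move=> Kx c1; have p0 := p_gt0; rewrite /character_form.
have mX alpha s : (1 <= s <= p)%N -> mchar (X alpha s) x = 0.
  by move=> /(X_std alpha) Xs; apply: mchar_simple_weight Xs _ _ Kx c1.
rewrite !mX ?p0 ?leqnn // !mulr0 !add0r big_nat big1 // => s /andP[s_gt0 sp].
rewrite !mX ?s_gt0 1?ltnW // !mulr0 !add0r /Gform.
rewrite (tr_Hmat_weight (P_std _ _) Kx c1); last by lia.
by rewrite (tr_Hmat_weight (P_std _ _) Kx c1) ?addr0 ?mulr0 //; lia.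
Qed.

(** Doubling makes X^-(p) and X^+(p) the end terms s = 0 and s = p of one sum, where x = q^s is 1
    and -1. *)
Lemma character_form_casimirE l j : character_form (casimir ^+ l * K ^+ j) *+ 2 =
  bracket l 1 * weight_sum 0 j + (-1) ^+ p * bracket l (-1) * weight_sum p j +
  (\sum_(1 <= s < p) (-1) ^+ s * bracket l (q ^+ s) * weight_sum s j) *+ 2.
Proof.
have p0 := p_gt0; have q0 := q_neq0.
have cv alpha s : (s <= p)%N -> casimir_value alpha (p - s) = casimir_value (~~ alpha) s.
  move=> sp; rewrite /casimir_value /sgnb.
  rewrite q_exprpB //.
  by case: alpha; rewrite /= ?expr1 ?expr0; field; rewrite expf_neq0 ?oppr_eq0 ?oner_neq0.
rewrite /character_form mulrnDl; congr (_ + _).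
  rewrite !(mchar_simple (X_std _ _)) ?p0 ?leqnn //.
  have := cv true 0%N (leq0n p); have := cv false 0%N (leq0n p); rewrite subn0 => -> ->.
  have := weight_sumE j (leqnn p); rewrite subnn big_ord0 addr0 => ->.
  have := weight_sumE j (leq0n p); rewrite subn0 big_ord0 add0r => ->.
  have -> : casimir_value true 0 = - 2%:R.
    by rewrite /casimir_value /sgnb !expr0 expr1 invr1 mulN1r.
  have -> : casimir_value false 0 = 2%:R by rewrite /casimir_value /sgnb !expr0 invr1 mul1r.
  have -> : bracket l 1 = 2%:R ^+ l.+1.
    by rewrite /bracket invr1 subrr expr0n /= mulr0 mul0r addr0.
  have -> : bracket l (-1) = (- 2%:R) ^+ l.+1.
    by rewrite /bracket invrN invr1 subrr expr0n /= mulr0 mul0r addr0 -opprD.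
  have -> : (-1) ^+ p = - (-1) ^+ (p - 1) :> C.
    by rewrite -{1}(subnK p0) addn1 exprS mulN1r.
  by rewrite /= !exprS; ring.
congr (_ *+ 2).
(* Reindexing by p - s pairs X^+(s) with X^-(p-s): they share the Casimir value, together carry the
   weights of [weight_sum], and match the two parts of G_s. *)
transitivity (\sum_(1 <= s < p) ((-1) ^+ s * (q ^+ s + q ^- s) * mchar (X false s) (casimir ^+ l * K ^+ j)
    + (-1) ^+ s * qint q s ^+ 2 * Gform P s (casimir ^+ l * K ^+ j)) +
  \sum_(1 <= s < p) (-1) ^+ (s - 1) * (q ^+ (p - s) + q ^- (p - s)) *
     mchar (X true (p - s)) (casimir ^+ l * K ^+ j)).
  rewrite [X in _ = _ + X]big_nat_rev -big_split /= !big_nat.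
  apply: eq_bigr => s /andP[s_gt0 sp]; rewrite add1n subSS subKn 1?ltnW //.
  by rewrite addrAC.
rewrite -big_split /= !big_nat; apply: eq_bigr => s /andP[s_gt0 sp].
have sp' := ltnW sp.
have sX : (1 <= s <= p)%N by rewrite s_gt0.
have sX' : (1 <= p - s <= p)%N by lia.
rewrite (mchar_simple (X_std _ sX)) (mchar_simple (X_std _ sX')).
have sP : (1 <= s <= p - 1)%N by lia.
have sP' : (1 <= p - s <= p - 1)%N by lia.
rewrite /Gform (tr_Hmat_casimir (P_std _ sP)) (tr_Hmat_casimir (P_std _ sP')).
rewrite -weight_sumE // cv //=.
have -> : q ^+ (p - s) + q ^- (p - s) = casimir_value true s.
  by rewrite -[LHS]mul1r -[1](expr0 (-1)) -/(casimir_value false (p - s)) cv.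
rewrite /casimir_value /bracket /sgnb expr0 expr1 !mul1r.
have -> : (-1) ^+ (s - 1) = - (-1) ^+ s :> C.
  by rewrite -{2}(subnK s_gt0) addn1 exprS mulN1r opprK.
rewrite /qint [(q ^+ s + q ^- s) ^+ l.+1]exprS.
move: (\sum_(i < s) _) (\sum_(i < p - s) _) => S S'; field.
by rewrite expf_neq0 ?q0 ?q2_sub1_neq0.
Qed.

Lemma bracketV l x : bracket l x^-1 = bracket l x.
Proof. by rewrite /bracket invrK (addrC x) -(opprB x) sqrrN. Qed.

Lemma two_neq0 : 2%:R != 0 :> C.
Proof. by have := two_p_neq0; rewrite natrM mulf_eq0 negb_or => /andP[]. Qed.

(** The sign from [K^(p r)] combines with (-1)^s, and the symmetry of [bracket] under x -> 1/x
    unfolds the doubled sum to all 2p-th roots of unity. *)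
Lemma character_form_casimir_mul l r : character_form (casimir ^+ l * K ^+ (p * r)) *+ 2 =
  p%:R * (-1) ^+ r * \sum_(s < 2 * p) (-1) ^+ (~~ odd r * s) * bracket l (q ^+ s).
Proof.
have sgn s : (-1) ^+ s * (-1) ^+ (s * r) = (-1) ^+ (~~ odd r * s) :> C.
  rewrite -exprD -signr_odd -[RHS]signr_odd oddD !oddM oddb.
  by case: (odd s); case: (odd r).
rewrite character_form_casimirE (sum_symmetric (G := fun s => (-1) ^+ (~~ odd r * s) * bracket l (q ^+ s))).
  rewrite !weight_sum_mul muln0 !mul0n !expr0 !mul1r q_expr_p.
  have -> : \sum_(1 <= s < p) (-1) ^+ s * bracket l (q ^+ s) * weight_sum s (p * r) =
      p%:R * (-1) ^+ r *
      \sum_(1 <= s < p) (-1) ^+ (~~ odd r * s) * bracket l (q ^+ s).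
    rewrite mulr_sumr; apply: eq_bigr => s _; rewrite weight_sum_mul -sgn.
    by ring.
  by rewrite -(sgn p); ring.
move=> s /andP[s_gt0 sp].
have -> : q ^+ (2 * p - s) = (q ^+ s)^-1.
  apply: (mulfI (_ : q ^+ s != 0)); first by rewrite expf_neq0 ?q_neq0.
  rewrite mulfV ?expf_neq0 ?q_neq0 // -exprD subnKC ?(prim_expr_order q_prim) //.
  by lia.
rewrite bracketV; congr (_ * _); rewrite -signr_odd -[RHS]signr_odd !oddM.
by rewrite oddB ?oddM //; lia.
Qed.

Lemma character_form_casimir_ndvd l j : ~~ (p %| j)%N -> character_form (casimir ^+ l * K ^+ j) = 0.
Proof.
move=> pj; apply: (mulIf two_neq0); rewrite mul0r mulr_natr character_form_casimirE.
rewrite !weight_sum0 // !mulr0 addr0 add0r big1 ?mul0rn // => s _.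
by rewrite weight_sum0 ?mulr0.
Qed.

Lemma character_form_casimir_low l j : (l < p.-1)%N -> character_form (casimir ^+ l * K ^+ j) = 0.
Proof.
move=> lp; have [/dvdnP[r ->]|] := boolP (p %| j)%N; last exact: character_form_casimir_ndvd.
apply: (mulIf two_neq0); rewrite mul0r mulr_natr mulnC character_form_casimir_mul.
rewrite bracket_sum0 ?mulr0 //; first by lia.
by rewrite negb_and ltn_eqF ?orbT.
Qed.

(** Only j = 0 and j = p need the Fourier sum; for j = p the signs cancel and the sum is 0. *)
Lemma character_form_casimir_top j : (j < 2 * p)%N ->
  character_form (casimir ^+ p.-1 * K ^+ j) = (2 * p)%:R * p%:R ^+ 2 *+ (j == 0%N).
Proof.
move=> j2p; have p0 := p_gt0.
have [/dvdnP[r jr]|pj] := boolP (p %| j)%N; last first.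
  by rewrite character_form_casimir_ndvd //; case: j pj {j2p} => //; rewrite dvdn0.
apply: (mulIf two_neq0); rewrite mulr_natr jr mulnC character_form_casimir_mul.
have : (r < 2)%N by rewrite -(ltn_pmul2r p0) -jr.
case: r {jr} => [|[|//]] _ /=.
  rewrite muln0 eqxx expr0 mulr1n; under eq_bigr do rewrite mul1n.
  by rewrite bracket_sum_top natrM; ring.
by rewrite muln1 (gtn_eqF p0) (@bracket_sum0 false) ?mulr0 ?mul0r //; lia.
Qed.

Lemma character_form_monomial m n j : (m < p)%N -> (n < p)%N -> (j < 2 * p)%N ->
  character_form (F ^+ m * E ^+ n * K ^+ j) =
    (-1) ^+ p.-1 * (2 * p)%:R * qfact q p.-1 ^+ 2
    * (m == p.-1)%:R * (n == p.-1)%:R * (j == 0%N)%:R.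
Proof.
move=> mp np j2p.
have q2 : (q - q^-1) ^+ (2 * p.-1) != 0 by rewrite expf_neq0 ?q_sub_neq0.
have [<-|mn] := eqVneq m n; last first.
  (* For m and n distinct below p the factor q^(2(n-m)) is not 1, so the weight argument applies. *)
  rewrite (@character_form_weight (q ^- (2 * m) * q ^+ (2 * n))).
  - by have [<-|] := eqVneq m p.-1; rewrite ?mulr0 ?mul0r // eq_sym (negPf mn) mulr0 mul0r.
  - rewrite K_monomial exprSr !mulrA //.
  - apply: contra mn => /eqP qmn; have : q ^+ (2 * n) == q ^+ (2 * m).
      by rewrite -[q ^+ (2 * m)]mulr1 -qmn mulrA mulfV ?mul1r ?expf_neq0 ?q_neq0.
    by rewrite (eq_prim_root_expr q_prim) !modn_small ?ltn_pmul2l // eqn_pmul2l // eq_sym.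
have low := fun l j => @character_form_casimir_low l j.
have [mt|mt] := eqVneq m p.-1; last first.
  rewrite mulr0 !mul0r; have := @casimir_reduction character_form m 0 j low.
  by rewrite mul1r; apply; rewrite addn0; lia.
subst m; apply: (mulfI q2).
have top : (q - q^-1) ^+ (2 * p.-1) * character_form (F ^+ p.-1 * E ^+ p.-1 * K ^+ j) =
    character_form (casimir ^+ p.-1 * K ^+ j).
  have := @casimir_reduction_top character_form p.-1 0 j low.
  by rewrite addn0 mul1r; apply.
(* [qfact_sqr] converts p^2 into (q - q^-1)^(2(p-1)) (-1)^(p-1) ([p-1]!)^2. *)
by rewrite top character_form_casimir_top // -qfact_sqr !mulr1 -mulr_natr; ring.
Qed.

End CharacterFormula.

(** * The integral on the monomials, and comparison of the three forms *)

Lemma integral_monomial (mu : {scalar U}) (N : C) :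
  (forall m n j : nat, (m <= p - 1)%N -> (n <= p - 1)%N -> (j <= 2 * p - 1)%N ->
     mu (F ^+ m * E ^+ n * K ^+ j) =
       N * (m == p - 1)%N%:R * (n == p - 1)%N%:R * (j == p + 1)%N%:R) ->
  forall m n j, (m < p)%N -> (n < p)%N -> (j < 2 * p)%N ->
    mu (K ^+ (p + 1) * (F ^+ m * E ^+ n * K ^+ j)) =
      N * (m == p.-1)%:R * (n == p.-1)%:R * (j == 0%N)%:R.
Proof.
move=> muE m n j mp np j2p.
have KX i : K ^+ i * (F ^+ m * E ^+ n * K ^+ j) =
    (q ^- (2 * m) * q ^+ (2 * n)) ^+ i *: (F ^+ m * E ^+ n * K ^+ (j + i)).
  elim: i => [|i IHi]; first by rewrite mul1r scale1r addn0.
  by rewrite exprS -mulrA IHi -scalerAr K_monomial scalerA -exprSr addnS.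
(* The shifted exponent j + p + 1 is reduced modulo 2p; it becomes p + 1 exactly for j = 0. *)
have [k [k2p kE jk]] : exists k, [/\ (k < 2 * p)%N, K ^+ (j + (p + 1)) = K ^+ k &
    (k == p + 1)%N = (j == 0%N)].
  have [jp|pj] := ltnP (j + (p + 1)) (2 * p).
    by exists (j + (p + 1))%N; split => //; apply/eqP/eqP; lia.
  exists (j + (p + 1) - 2 * p)%N; split; first by lia.
    by rewrite -{1}(subnK pj) exprD (uq_K2p Uq) mulr1.
  by apply/eqP/eqP; lia.
rewrite KX linearZ_LR /= kE muE; try by lia.
rewrite jk !subn1.
have [->|] := eqVneq m p.-1; last by rewrite !(mulr0, mul0r).
have [->|] := eqVneq n p.-1; last by rewrite !(mulr0, mul0r).
by rewrite mulVf ?expf_neq0 ?q_neq0 // expr1n mul1r.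
Qed.

Lemma modified_trace_integral (X : bool -> nat -> fdmod U)
    (P : bool -> forall s : nat, based_mod U p s)
    (t : forall M : fdmod U, 'End(M) -> C) (mu : {scalar U}) :
  (forall alpha s, (1 <= s <= p)%N -> is_simple_X q E F K alpha s (X alpha s)) ->
  (forall alpha s, (1 <= s <= p - 1)%N -> is_proj_P q E F K alpha (P alpha s)) ->
  is_modified_trace (K ^+ (p + 1)) t ->
  t (X false p) \1%VF = (-1) ^+ (p - 1) ->
  (forall m n j : nat, (m <= p - 1)%N -> (n <= p - 1)%N -> (j <= 2 * p - 1)%N ->
     mu (F ^+ m * E ^+ n * K ^+ j) =
       (-1) ^+ (p - 1) * (2 * p)%:R * qfact q (p - 1) ^+ 2
       * (m == p - 1)%N%:R * (n == p - 1)%N%:R * (j == p + 1)%N%:R) ->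
  (forall a : U, trace_slf t a = mu (K ^+ (p + 1) * a)) /\
  (forall a : U, mu (K ^+ (p + 1) * a) = character_form X P a).
Proof.
move=> X_std P_std t_mod t_norm muE; have p0 := p_gt0.
have mu_mono := integral_monomial muE; rewrite subn1 in mu_mono t_norm.
pose muK : {scalar U} := mu \o amull (K ^+ (p + 1)).
have muKE a : mu (K ^+ (p + 1) * a) = muK a by rewrite /muK /= lfunE.
have [v v_std] : is_simple_X q E F K false 2 (X false 2) by apply: X_std.
have [w w_std] : is_simple_X q E F K false p (X false p).
  by apply: X_std; rewrite p0 leqnn.
have t_mono := modified_trace_monomial v_std t_mod.
have t_top : trace_slf t (F ^+ p.-1 * E ^+ p.-1) =
    (-1) ^+ p.-1 * (2 * p)%:R * qfact q p.-1 ^+ 2.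
  rewrite (trace_steinberg w_std t_mod.1) => [|j /andP[j0 j2p]].
    by rewrite t_norm; ring.
  by rewrite t_mono ?ltn_predL // (gtn_eqF j0) mulr0.
have t_lin : scalar (trace_slf t) by move=> c a b; apply: (is_traceE t_mod.1).
pose mt := GRing.isSemilinear.Build C U C _ _ (GRing.semilinear_linear t_lin).
pose tl : {scalar U} := HB.pack (trace_slf t) mt.
split=> a; rewrite muKE.
  apply: (monomial_ext (f := tl) (g := muK)) => m n j mp np j2p.
  by rewrite -muKE mu_mono //= t_mono // t_top.
apply: (monomial_ext (f := muK) (g := character_form X P)) => m n j mp np j2p.
by rewrite -muKE mu_mono //= (character_form_monomial X_std P_std).
Qed.

End RestrictedQuantumGroup.

(** * The number exp(i pi / p) as a primitive 2p-th root of unity *)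

Section RootOfUnity.
Import Order.TTheory Num.Theory.
Variables (R : realType) (p : nat).
Hypothesis p_gt0 : (0 < p)%N.

Lemma qroot_expr n : qroot R p ^+ n =
  Complex (cos (pi / p%:R *+ n)) (sin (pi / p%:R *+ n)).
Proof.
elim: n => [|n IHn]; first by rewrite expr0 mulr0n cos0 sin0.
by rewrite exprS IHn mulrS cosD sinD [X in _ = Complex _ X]addrC.
Qed.

(** For 0 < n < p the imaginary part sin(pi n / p) is positive, so q^n is neither 1 nor -1;
    exponents beyond p reduce to these through q^p = -1. *)
Lemma qroot_prim : (2 * p).-primitive_root (qroot R p).
Proof.
have pR0 : (0 < p%:R :> R) by rewrite ltr0n.
have qp : qroot R p ^+ p = -1.
  rewrite qroot_expr -mulr_natr mulfVK ?gt_eqF // cospi sinpi.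
  by apply/eqP; rewrite eq_complex /= oppr0 !eqxx.
have Im_gt0 n : (0 < n < p)%N -> 0 < complex.Im (qroot R p ^+ n).
  case/andP=> n_gt0 np; rewrite qroot_expr /= sin_gt0_pi // -mulr_natr.
  rewrite mulr_gt0 ?divr_gt0 ?pi_gt0 ?ltr0n //= mulrAC ltr_pdivrMr //.
  by rewrite ltr_pM2l ?pi_gt0 // ltr_nat.
have qn_neq n : (0 < n < p)%N -> (qroot R p ^+ n != 1) && (qroot R p ^+ n != -1).
  move=> /Im_gt0 qn; apply/andP; split; apply: contraTneq qn => ->.
    by rewrite /= ltxx.
  by rewrite /= oppr0 ltxx.
apply/andP; split; first by rewrite muln_gt0.
apply/forallP => i; rewrite unity_rootE; apply/eqP.
have [i_eq|i_neq] := eqVneq i.+1 (2 * p)%N.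
  by rewrite i_eq mulnC exprM qp expr2 mulrNN mulr1 eqxx.
have i_lt := ltn_ord i.
have [ip|pi|->] := ltngtP i.+1 p.
- by apply/negbTE; have /andP[] := qn_neq i.+1 ip.
- have -> : i.+1 = (p + (i.+1 - p))%N by lia.
  rewrite exprD qp mulN1r; apply/negbTE; rewrite eqr_oppLR.
  have /qn_neq/andP[_ //] : (0 < i.+1 - p < p)%N by move: i_neq; lia.
- by rewrite qp eqNr oner_eq0.
Qed.

End RootOfUnity.

Unset Implicit Arguments.
Set Strict Implicit.
Set Printing Implicit Defensive.

Theorem mainTheorem3 (R : realType) (p : nat) (U : hopfAlg R[i]) (E F K : U)
    (X : bool -> nat -> fdmod U)
    (P : bool -> forall s : nat, based_mod U p s)
    (t : forall M : fdmod U, 'End(M) -> R[i])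
    (mu : {scalar U}) :
  let q : R[i] := qroot R p in
  (2 <= p)%N ->
  is_Uqsl2 p q E F K ->
  (forall (alpha : bool) (s : nat), (1 <= s <= p)%N ->
     is_simple_X q E F K alpha s (X alpha s)) ->
  (forall (alpha : bool) (s : nat), (1 <= s <= p - 1)%N ->
     is_proj_P q E F K alpha (P alpha s)) ->
  is_modified_trace (K ^+ (p + 1)) t ->
  t (X false p) \1%VF = (-1) ^+ (p - 1) ->
  right_integral mu ->
  (forall m n j : nat, (m <= p - 1)%N -> (n <= p - 1)%N ->
     (j <= 2 * p - 1)%N ->
     mu (F ^+ m * E ^+ n * K ^+ j) =
       (-1) ^+ (p - 1) * (2 * p)%:R * qfact q (p - 1) ^+ 2
       * (m == p - 1)%N%:R * (n == p - 1)%N%:R * (j == p + 1)%N%:R) ->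
  (forall a : U, trace_slf t a = mu (K ^+ (p + 1) * a)) /\
  (forall a : U,
     mu (K ^+ (p + 1) * a) =
       (-1) ^+ (p - 1) * mchar (X false p) a + mchar (X true p) a
       + \sum_(1 <= s < p)
           ((-1) ^+ s * (q ^+ s + q ^- s) * mchar (X false s) a
            + (-1) ^+ (p - s - 1) * (q ^+ s + q ^- s) * mchar (X true s) a
            + (-1) ^+ s * qint q s ^+ 2 * Gform P s a)).
Proof.
move=> q p_gt1 Uq X_std P_std t_mod t_norm _ muE.
have q_prim : (2 * p).-primitive_root q by apply: qroot_prim; apply: ltnW.
exact: (modified_trace_integral p_gt1 q_prim Uq X_std P_std t_mod t_norm muE).
Qed.
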